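(* Let $m,n\ge 1$ and let $A$ be an $m\times n$ binary matrix. Then $$\overline{\operatorname{rec}(A)}=\operatorname{ins}(A^\dagger).$$
   Context: Notation: $[k]=\{1,\dots,k\}$. $\mathrm{BM}_{m\times n}$ is the set of $m\times n$ matrices with entries in $\{0,1\}$. For $A\in\mathrm{BM}_{m\times n}$, $A^\dagger\in\mathrm{BM}_{n\times m}$ is the transpose-complement: $(A^\dagger)_{ji}=1-A_{ij}$. Reverse semistandard convention: tableaux are fillings of Young diagrams (English convention) weakly decreasing along rows and strictly decreasing down columns; $\operatorname{shape}(T)$ is the underlying diagram and $\lambda^{t}$ is the conjugate partition. Super pipe dreams. Tiles are positions $(r,c)\in\mathbb Z^2$, rows $r$ numbered from top to bottom, columns $c$ from left to right. A super pipe dream is a pair $P=(P_x,P_y)$ of finite subsets of $\mathbb Z^2$; elements of $P_x$ are black checkers, elements of $P_y$ are red checkers. A tile is unoccupied if it contains no checker. A matrix $A\in \mathrm{BM}_{m\times n}$ is identified with the super pipe dream with a black checker at $(r,c)$ when $A_{rc}=1$ and a red checker at $(r,c)$ when $A_{rc}=0$, for $(r,c)\in[m]\times[n]$, and no other checkers. Flow operators. If $P$ has no red checkers in column $i+1$, then $Y_i^+P$ is obtained by repeating the following until column $i$ has no red checkers. Choose the lowest red checker in column $i$, say at $(r,i)$. (1) If $(r,i+1)$ contains a black checker, move the red checker to $(r,i+1)$ and, if $(r,i)$ contains no black checker, move the black checker at $(r,i+1)$ to $(r,i)$. (2) Otherwise let $k\ge1$ be minimal such that $(r-k,i)$ is unoccupied;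 move the red checker from $(r,i)$ to $(r-k,i+1)$, and for each $0<l<k$ such that $(r-l,i+1)$ is unoccupied, move the contents of $(r-l,i)$ to $(r-l,i+1)$. Define $Y^+=\cdots Y_{-1}^+Y_0^+Y_1^+\cdots$ (operators act right to left, so columns are processed from right to left; only finitely many factors act nontrivially on a given $P$). Rectification. For $N$ sufficiently large all red checkers of $(Y^+)^NP$ lie northeast of all its black checkers; the set $V$ of positions of the black checkers of $(Y^+)^NP$ is the black component of $\operatorname{Rect}(P)$. Tableau of a pipe dream. View $V$ (a finite set of tiles in positive rows and columns) as a pipe dream: tiles in $V$ are crosses, all others are bumps (a pipe entering a bump from the left exits at the top, one entering from the bottom exits to the right). For $V$ arising from a super pipe dream with $m$ rows, $\operatorname{tab}(V)$ is the reverse semistandard tableau whose rows, from top to bottom, come from the pipes entering at the left edge in rows $m,m-1,\dots,1$: the row coming from a pipe lists, in order along the pipe from its left end, the row indices of the crosses the pipe passes horizontally (empty rows are omitted). Define $\operatorname{ins}(A)=\operatorname{tab}(V)$ where $V$ is the black component of $\operatorname{Rect}(A)$. For $A^\dagger\in \mathrm{BM}_{n\times m}$ the same definition is used with $n$ rows. Recording tableau. Let $C_1,\dots,C_n$ be the columns of $A$ and $A_i'=[C_i\ C_{i+1}\cdots C_n]\in\mathrm{BM}_{m\times(n-i+1)}$. Define nested tableaux $T_n\subseteq T_{n-1}\subseteq\cdots\subseteq T_1$ by $\operatorname{shape}(T_i)=\operatorname{shape}(\operatorname{ins}(A_i'))^{t}$, all entries of $T_n$ equal to $n$, and all entries of $T_{i-1}\setminus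 T_i$ equal to $i-1$ for $2\le i\le n$. Then $\operatorname{rec}(A)=T_1$. Complement. For a tableau $T$ let $\operatorname{col}_q(T)$ be the set of entries of its $q$-th column (empty if the column is missing). $\operatorname{rec}(A)$ has entries in $[n]$ and at most $m$ columns, and $\overline{\operatorname{rec}(A)}$ is the tableau with columns $\operatorname{col}_q(\overline{\operatorname{rec}(A)})=[n]\setminus\operatorname{col}_{m+1-q}(\operatorname{rec}(A))$, $q\in[m]$, each written in decreasing order. *)

(* Defs.v *)
From mathcomp Require Import all_boot all_order all_algebra finmap.
From mathcomp Require Import zify.

Set Implicit Arguments.
Unset Strict Implicit.
Unset Printing Implicit Defensive.

Import Order.TTheory GRing.Theory Num.Theory.
Local Open Scope fset_scope.
Local Open Scope ring_scope.

(* (row, column); rows increase downwards, columns to the right. *)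
Definition tile : Type := (int * int)%type.

Definition super_pipe_dream : Type := ({fset tile} * {fset tile})%type.
Definition black (P : super_pipe_dream) : {fset tile} := P.1.
Definition red (P : super_pipe_dream) : {fset tile} := P.2.
Definition unoccupied (P : super_pipe_dream) (t : tile) : bool :=
  (t \notin black P) && (t \notin red P).

(* Matrix indices start at 0, rows and columns of tiles at 1. *)
Definition matrix_tile m n (rc : 'I_m * 'I_n) : tile :=
  ((rc.1.+1)%:Z, (rc.2.+1)%:Z).

Definition spd_of_matrix m n (A : 'M[bool]_(m, n)) : super_pipe_dream :=
  ([fset matrix_tile rc | rc in [set rc : 'I_m * 'I_n | A rc.1 rc.2]],
   [fset matrix_tile rc | rc in [set rc : 'I_m * 'I_n | ~~ A rc.1 rc.2]]).

Definition transpose_complement m n (A : 'M[bool]_(m, n)) : 'M[bool]_(n, m) :=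
  \matrix_(j, i) ~~ A i j.

Lemma fset_bound (T : choiceType) (S : {fset T}) (f : T -> int) :
  exists C : int, forall t, t \in S -> f t <= C.
Proof.
have [C HC] : exists C : int, forall t, t \in enum_fset S -> f t <= C.
  elim: (enum_fset S) => [|x s [C HC]]; first by exists 0.
  exists (Order.max C (f x)) => t; rewrite inE le_max => /orP[/eqP->|/HC ->] //.
  by rewrite lexx orbT.
by exists C.
Qed.

Lemma gap_ex (P : super_pipe_dream) (r i : int) :
  exists k : nat, (0 < k)%N && unoccupied P (r - k%:Z, i).
Proof.
have [C HC] := fset_bound (black P `|` red P) (fun t => - t.1).
exists (absz (r + C)).+1; rewrite /= /unoccupied -negb_or -in_fsetU.
by apply/negP => /HC /=; lia.
Qed.

Definition gap (P : super_pipe_dream) (r i : int) : nat := ex_minn (gap_ex P r i).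

Definition red_rows (i : int) (P : super_pipe_dream) : {fset int} :=
  [fset t.1 | t in red P & t.2 == i].

(* One round of the procedure defining Y_i^+; the identity when column i has no
   red checker.  The new position of each checker is given as a function of
   its old one. *)
Definition flow_step (i : int) (P : super_pipe_dream) : super_pipe_dream :=
  if sort (fun r s : int => s <= r) (red_rows i P) is r :: _ then
    if (r, i + 1) \in black P then
      ([fset (if (t == (r, i + 1)) && ((r, i) \notin black P) then (r, i) else t)
          | t in black P],
       [fset (if t == (r, i) then (r, i + 1) else t) | t in red P])
    else
      let k := gap P r i in
      let push (t : tile) : tile :=
        if [&& t.2 == i, r - k%:Z < t.1, t.1 < r & unoccupied P (t.1, i + 1)]
        then (t.1, i + 1) else t in
      ([fset push t | t in black P],
       [fset (if t == (r, i) then (r - k%:Z, i + 1) else push t) | t in red P])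
  else P.

(* Each effective round lowers the number of red checkers in column i, so
   #|red P| rounds empty that column (Ycol_no_red).  The operator Y_i^+ is meant for P
   without red checkers in column i + 1, which holds at each use in Yplus. *)
Definition Ycol (i : int) (P : super_pipe_dream) : super_pipe_dream :=
  iter #|` red P| (flow_step i) P.

(* The infinite product restricted to the columns with red checkers, from right
   to left; a factor Y_j^+ moves red checkers only from column j to column
   j + 1, so the other factors are trivial. *)
Definition Yplus (P : super_pipe_dream) : super_pipe_dream :=
  foldl (fun Q i => Ycol i Q) P
    (sort (fun i j : int => j <= i) [fset t.2 | t in red P]).

Definition separated (P : super_pipe_dream) : bool :=
  all (fun b : tile => all (fun y : tile => (y.1 < b.1) && (b.2 < y.2)) (red P))
    (black P).

Lemma separatedP P :
  reflect (forall b y, b \in black P -> y \in red P -> y.1 < b.1 /\ b.2 < y.2)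
          (separated P).
Proof.
apply: (iffP allP) => [H b y bP yP | H b bP].
  by have /allP/(_ _ yP)/andP := H _ bP.
by apply/allP => y yP; apply/andP; apply: H.
Qed.

Variant flow_step_spec i P : super_pipe_dream -> Prop :=
| FlowId of (forall y, y \in red P -> y.2 != i) : flow_step_spec i P P
| FlowCase1 r of (r, i) \in red P
    & (forall y, y \in red P -> y.2 = i -> y.1 <= r)
    & (r, i + 1) \in black P :
    flow_step_spec i P
      ([fset (if (t == (r, i + 1)) && ((r, i) \notin black P) then (r, i) else t)
          | t in black P],
       [fset (if t == (r, i) then (r, i + 1) else t) | t in red P])
| FlowCase2 r (k : nat) (push : tile -> tile) of (r, i) \in red P
    & (forall y, y \in red P -> y.2 = i -> y.1 <= r)
    & (r, i + 1) \notin black P & (0 < k)%N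
    & (forall t, push t = if [&& t.2 == i, r - k%:Z < t.1, t.1 < r
                                & unoccupied P (t.1, i + 1)]
                          then (t.1, i + 1) else t) :
    flow_step_spec i P
      ([fset push t | t in black P],
       [fset (if t == (r, i) then (r - k%:Z, i + 1) else push t) | t in red P]).

Lemma flow_stepP i P : flow_step_spec i P (flow_step i P).
Proof.
rewrite /flow_step.
have memE r : (r \in sort (fun r s : int => s <= r) (red_rows i P)) =
              ((r, i) \in red P).
  rewrite mem_sort; apply/imfsetP/idP => [[[r' c] /= + ->]|rP].
    by rewrite !inE /= => /andP[+ /eqP<-].
  by exists (r, i) => //; rewrite !inE /= rP eqxx.
have: sorted (fun r s : int => s <= r) (sort (fun r s : int => s <= r) (red_rows i P)).
  by apply: sort_sorted => r s; apply: le_total.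
case: (sort _ _) memE => [|r s] memE srt.
  apply: FlowId => -[r c] yP /=; apply/eqP => ci.
  by move: (memE r); rewrite -ci yP.
have rP : (r, i) \in red P by rewrite -memE mem_head.
have rmax y : y \in red P -> y.2 = i -> y.1 <= r.
  case: y => r' c /= yP ci; move: yP; rewrite ci -memE inE => /orP[/eqP->//|].
  move: srt; rewrite /= path_sortedE; last by move=> a b c' ab bc; apply: le_trans bc ab.
  by move=> /andP[/allP H _] /H.
case: ifP => [bP|/negbT bP]; first exact: FlowCase1.
rewrite /=; apply: FlowCase2 => //.
by rewrite /gap; case: ex_minnP => k /andP[].
Qed.

Lemma flow_step_red i P y : y \in red (flow_step i P) ->
  exists2 x, x \in red P & y.1 <= x.1 /\ x.2 <= y.2 /\
    (y = x /\ y.2 != i \/ y.2 = i /\ y = x \/ x.2 = i /\ y.2 = i + 1).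
Proof.
case: flow_stepP => [_ yP|r rP _ _|r k push rP _ _ k0 pushE].
- by exists y => //; do 2!split=> //; case: (eqVneq y.2 i); [right; left|left].
- move=> /imfsetP[x /= xP ->]; exists x => //.
  case: eqP => [->|_] /=; first by do 2![split; first lia]; right; right.
  by do 2!split=> //; case: (eqVneq x.2 i); [right; left|left].
- move=> /imfsetP[x /= xP ->]; exists x => //.
  case: eqP => [->|_] /=; first by do 2![split; first lia]; right; right.
  rewrite pushE; case: ifP => [/and4P[/eqP xi _ _ _]|_] /=.
    by split; [|split; [lia|right; right]].
  by do 2!split=> //; case: (eqVneq x.2 i); [right; left|left].
Qed.

Lemma card_red_flow_step i P : (#|` red (flow_step i P)| <= #|` red P|)%N.
Proof.
by case: flow_stepP => // *; apply: leq_trans (leq_imfset_card _ _ _) _.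
Qed.

Definition reds_in (i : int) (P : super_pipe_dream) : {fset tile} :=
  [fset y in red P | y.2 == i].

Lemma card_reds_in i P : (#|` reds_in i (flow_step i P)| <= #|` reds_in i P|.-1)%N.
Proof.
case: flow_stepP => [H|r rP _ _|r k push rP _ _ k0 pushE].
- suff -> : reds_in i P = fset0 by rewrite cardfs0.
  by apply/fsetP => y; rewrite !inE /=; apply/negP => /andP[/H/negbTE->].
- have rI : (r, i) \in reds_in i P by rewrite !inE /= rP eqxx.
  rewrite (cardfsD1 (r, i) (reds_in i P)) rI /=.
  apply/fsubset_leq_card/fsubsetP => y.
  rewrite !inE /= => /andP[/imfsetP[x /= xP ->]].
  case: ifP => [_|/negbT xr] /=; first by lia.
  by move=> xi; rewrite xr xP.
- have rI : (r, i) \in reds_in i P by rewrite !inE /= rP eqxx.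
  rewrite (cardfsD1 (r, i) (reds_in i P)) rI /=.
  apply/fsubset_leq_card/fsubsetP => y.
  rewrite !inE /= => /andP[/imfsetP[x /= xP ->]].
  case: ifP => [_|/negbT xr] /=; first by lia.
  by rewrite pushE; case: ifP => _ /=; [lia | rewrite xP xr].
Qed.

Lemma Ycol_no_red i P y : y \in red (Ycol i P) -> y.2 != i.
Proof.
have H n : (#|` reds_in i (iter n (flow_step i) P)| <= #|` reds_in i P| - n)%N.
  elim: n => [|n IH]; first by rewrite subn0.
  rewrite iterS; apply: leq_trans (card_reds_in _ _) _; lia.
move=> yP; apply/negP => yi.
have := H #|` red P|.
have -> : (#|` reds_in i P| - #|` red P| = 0)%N.
  apply/eqP; rewrite subn_eq0; apply/fsubset_leq_card/fsubsetP => z.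
  by rewrite !inE => /andP[].
rewrite leqn0 cardfs_eq0 => /eqP/fsetP/(_ y).
by rewrite !inE yi andbT => ny; move: yP; rewrite /Ycol /= ny.
Qed.

Lemma Yplus_ind (I : super_pipe_dream -> Prop) P :
  (forall i Q, I Q -> I (flow_step i Q)) -> I P -> I (Yplus P).
Proof.
move=> step; rewrite /Yplus; move: (sort _ _) => s.
elim: s P => //= i s IH P IP; apply: IH; rewrite /Ycol.
by elim: #|` _| => //= n; apply: step.
Qed.

Lemma Yplus_col P (c : int) : (forall y, y \in red P -> c <= y.2) ->
  forall y, y \in red (Yplus P) -> c + 1 <= y.2.
Proof.
rewrite /Yplus; set s := sort _ _ => Hc.
have s_c : forall i, i \in s -> c <= i.
  by move=> i; rewrite mem_sort => /imfsetP[y /= /Hc + ->].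
have Hs : forall y, y \in red P -> y.2 \in s \/ c + 1 <= y.2.
  by move=> y yP; left; rewrite mem_sort; apply/imfsetP; exists y.
clearbody s; elim: s P s_c Hs {Hc} => [|i s IH] P s_c Hs y /=; first by case/Hs.
apply: (IH) => [j js|{}y yP]; first by apply: s_c; rewrite inE js orbT.
have yi := Ycol_no_red yP.
have : y.2 \in i :: s \/ c + 1 <= y.2; last by rewrite inE (negbTE yi).
have ci : c <= i by apply: s_c; rewrite mem_head.
move: yP; rewrite /Ycol; elim: #|` _| y {yi} => [|n IHn] y /=; first exact: Hs.
move=> /flow_step_red[x xP [_ [_]]] [[-> _]|[[_ ->]|[_ yi]]]; try exact: IHn.
by right; rewrite yi; lia.
Qed.

Definition below (r : int) (P : super_pipe_dream) : {fset tile} :=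
  [fset y in red P | r < y.1].

Definition capped (C : int) (P : super_pipe_dream) : Prop :=
  forall b, b \in black P -> b.2 + #|` below b.1 P|%:Z <= C.

Lemma below_step i P r : (#|` below r (flow_step i P)| <= #|` below r P|)%N.
Proof.
suff [g Hg gE] : exists2 g : tile -> tile, forall t, (g t).1 <= t.1
    & red (flow_step i P) = [fset g t | t in red P].
  have: below r (flow_step i P) `<=` [fset g t | t in below r P].
    apply/fsubsetP => y; rewrite !inE gE => /andP[/imfsetP[x /= xP ->] rx].
    apply/imfsetP; exists x => //=; rewrite !inE xP /=.
    exact: lt_le_trans (Hg x).
  by move/fsubset_leq_card/leq_trans; apply; apply: leq_imfset_card.
case: flow_stepP => [H|r' rP _ _|r' k push rP _ _ k0 pushE].
- exists id => //; apply/fsetP => y; apply/idP/imfsetP => [yP|[x /= xP ->]] //.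
  by exists y.
- exists (fun t => if t == (r', i) then (r', i + 1) else t) => // t.
  by case: eqP => [->|].
- exists (fun t => if t == (r', i) then (r' - k%:Z, i + 1) else push t) => // t.
  by case: eqP => [->|_] /=; [lia | rewrite pushE; case: ifP].
Qed.

Lemma capped_step C i P : capped C P -> capped C (flow_step i P).
Proof.
move=> HC b bP; have lb := below_step i P b.1; move: bP lb.
case: flow_stepP => [_|r rP _ bP|r k push rP _ _ k0 pushE].
- by move=> /HC.
- move=> /imfsetP[t /= tP ->]; have := HC _ tP.
  by case: ifP => [/andP[/eqP-> _]|_] /=; lia.
- move=> /imfsetP[t /= tP ->]; have := HC _ tP.
  rewrite pushE; case: ifP => [/and4P[/eqP ti rt tr _]|_] /=; last lia.
  move=> H _.
  set P' := (X in below t.1 X).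
  suff lt : (#|` below t.1 P'| < #|` below t.1 P|)%N.
    by apply: le_trans H; rewrite ti -addrA lerD2l -[1]/(1%:Z) -PoszD lez_nat add1n.
  have rI : (r, i) \in below t.1 P by rewrite !inE rP.
  rewrite (cardfsD1 (r, i) (below t.1 P)) rI add1n ltnS.
  suff : below t.1 P' `<=` [fset push x | x in below t.1 P `\ (r, i)].
    by move/fsubset_leq_card/leq_trans; apply; apply: leq_imfset_card.
  apply/fsubsetP => y; rewrite !inE => /andP[/imfsetP[x /= xP ->]].
  case: ifP => [_|/negbT xr] /=; first by lia.
  move=> tx; apply/imfsetP; exists x => //=; rewrite !inE xr xP /=.
  by move: tx; rewrite pushE; case: ifP.
Qed.

Definition col_separated (P : super_pipe_dream) : Prop :=
  forall b y, b \in black P -> y \in red P -> b.2 < y.2.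

Lemma col_separated_step i P : col_separated P ->
  black (flow_step i P) = black P /\ col_separated (flow_step i P).
Proof.
move=> sP; have bE : black (flow_step i P) = black P.
  case: flow_stepP => [//|r rP _ bP|r k push rP _ _ k0 pushE].
    by have := sP _ _ bP rP; rewrite /=; lia.
  have pid t : t \in black P -> push t = t.
    by move=> tP; have := sP _ _ tP rP; rewrite pushE /=; case: ifP => //; lia.
  apply/fsetP => t; apply/imfsetP/idP => [[x /= xP ->]|tP]; first by rewrite pid.
  by exists t => //; rewrite pid.
split=> // b y; rewrite bE => bP /flow_step_red[x xP [_ [xy _]]].
exact: lt_le_trans (sP _ _ bP xP) xy.
Qed.

Lemma col_separated_Yplus P : col_separated P ->
  black (Yplus P) = black P /\ col_separated (Yplus P).
Proof.
move=> sP; apply: (@Yplus_ind (fun Q => black Q = black P /\ col_separated Q)) => //.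
by move=> i Q [<-]; apply: col_separated_step.
Qed.

Lemma Yplus_row P (R : int) : col_separated P ->
  (forall y, y \in red P -> y.1 <= R) ->
  forall y, y \in red (Yplus P) -> y.1 <= R - 1.
Proof.
rewrite /Yplus; set s := sort _ _ => sP HR.
have Hs : forall y, y \in red P -> y.1 <= R /\ y.2 \in s \/ y.1 <= R - 1.
  move=> y yP; left; split; first exact: HR.
  by rewrite mem_sort; apply/imfsetP; exists y.
clearbody s; elim: s P sP Hs {HR} => [|i s IH] P sP Hs y /=.
  by case/Hs => [[]|].
have H n : col_separated (iter n (flow_step i) P) /\
   forall y, y \in red (iter n (flow_step i) P) ->
     y.1 <= R /\ y.2 \in i :: s \/ y.1 <= R - 1.
  elim: n => [//|n [+ Hn]]; rewrite iterS; set Q := iter _ _ _ in Hn * => sQ.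
  split; first by case: (col_separated_step i sQ).
  move=> z; case: flow_stepP => [_|r rP _ bP|r k push rP rmax _ k0 pushE].
  - exact: Hn.
  - by have := sQ _ _ bP rP; rewrite /=; lia.
  - have rR : r <= R by have := Hn _ rP; rewrite /=; lia.
    move=> /imfsetP[x /= xP ->]; case: eqP => _ /=; first by right; lia.
    rewrite pushE; case: ifP => [/and4P[_ _ xr _] /=|_]; last exact: Hn.
    by right; lia.
apply: IH => [|{}y yP]; first by case: (H #|` red P|).
have yi := Ycol_no_red yP.
by case: (H #|` red P|) => _ /(_ _ yP); rewrite inE (negbTE yi).
Qed.

Lemma separated_Yplus P : separated P ->
  separated (Yplus P) /\ black (Yplus P) = black P.
Proof.
move=> /separatedP sP.
have csP : col_separated P by move=> b y bP yP; case: (sP b y bP yP).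
have [bE _] := col_separated_Yplus csP; split=> //; apply/separatedP.
rewrite bE => b y bP; move: y.
apply: (@Yplus_ind (fun Q => forall y, y \in red Q -> y.1 < b.1 /\ b.2 < y.2)) => //.
  move=> i Q IQ z /flow_step_red[x /IQ + [zx [xz _]]]; lia.
by move=> z; apply: sP.
Qed.

Lemma rect_ex (P : super_pipe_dream) : exists N, separated (iter N Yplus P).
Proof.
have [C HC] := fset_bound (black P) (fun b => b.2 + #|` below b.1 P|%:Z).
have [c Hc] := fset_bound (red P) (fun y => - y.2).
have cols n : forall y, y \in red (iter n Yplus P) -> - c + n%:Z <= y.2.
  elim: n => [y /Hc|n IH y /(Yplus_col IH)]; rewrite /=; lia.
have cap n : capped C (iter n Yplus P).
  by elim: n => //= n IH; apply: Yplus_ind IH => i Q; apply: capped_step.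
pose n1 := (absz (C + c)).+1.
have sP : col_separated (iter n1 Yplus P).
  by move=> b y /cap + /cols; rewrite /n1; lia.
pose Q := iter n1 Yplus P.
have [R HR] := fset_bound (red Q) (fun y => y.1).
have [B HB] := fset_bound (black Q) (fun b => - b.1).
have Hn n : [/\ black (iter n Yplus Q) = black Q, col_separated (iter n Yplus Q)
    & forall y, y \in red (iter n Yplus Q) -> y.1 <= R - n%:Z].
  elim: n => [|n [bE sn rn]]; first by split=> // y /HR; rewrite /=; lia.
  have [bE' sn'] := col_separated_Yplus sn.
  split=> //=; first by rewrite bE'.
  by move=> y /(Yplus_row sn rn) /le_trans; apply; lia.
pose n2 := (absz (R + B)).+1.
exists (n2 + n1)%N; rewrite iterD -/Q; apply/separatedP.
have [bE sn rn] := Hn n2 => b y bP yP; split; last exact: sn.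
by move: bP; rewrite bE => /HB; have := rn _ yP; rewrite /n2; lia.
Qed.

(* The number of iterations is immaterial once it is large enough, see
   rect_black_large. *)
Definition rect_black (P : super_pipe_dream) : {fset tile} :=
  black (iter (ex_minn (rect_ex P)) Yplus P).

Lemma rect_black_large (P : super_pipe_dream) :
  exists N0 : nat, forall N : nat, (N0 <= N)%N ->
    separated (iter N Yplus P) /\ black (iter N Yplus P) = rect_black P.
Proof.
rewrite /rect_black; case: ex_minnP => N0 sN _; exists N0 => N /subnK <-.
rewrite iterD; elim: (N - N0)%N => //= n [sn <-].
exact: separated_Yplus.
Qed.

Definition tableau : Type := seq (seq nat).

(* A state of a pipe is the tile it is entering, together with true if it enters
   from the left and false if it enters from the bottom. *)
Definition pipe_step (V : {fset tile}) (s : tile * bool) : tile * bool :=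
  let: (r, c, from_left) := s in
  let to_right := if (r, c) \in V then from_left else ~~ from_left in
  (if to_right then (r, c + 1) else (r - 1, c), to_right).

Definition pipe_state (V : {fset tile}) (r : nat) (k : nat) : tile * bool :=
  iter k (pipe_step V) ((r%:Z, 1), true).

Definition pipe_row_upto (V : {fset tile}) (r K : nat) : seq nat :=
  [seq absz (pipe_state V r k).1.1
     | k <- iota 0 K & ((pipe_state V r k).1 \in V) && (pipe_state V r k).2].

(* After this many steps the pipe is above row 1 or to the right of V, see
   pipe_row_large. *)
Definition pipe_length (V : {fset tile}) (r : nat) : nat :=
  (r + \max_(t <- V) absz t.2)%N.

Definition pipe_row (V : {fset tile}) (r : nat) : seq nat :=
  pipe_row_upto V r (pipe_length V r).

Lemma pipe_row_large (V : {fset tile}) (r K : nat) :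
  (forall t, t \in V -> 0 < t.1) -> (pipe_length V r <= K)%N ->
  pipe_row_upto V r K = pipe_row V r.
Proof.
move=> posV /subnKC <-; rewrite /pipe_row /pipe_row_upto iotaD filter_cat map_cat.
suff -> : [seq k <- iota (0 + pipe_length V r) (K - pipe_length V r)
    | ((pipe_state V r k).1 \in V) && (pipe_state V r k).2] = [::] by rewrite cats0.
apply/eqP; rewrite -[_ == _]negbK -has_filter -all_predC; apply/allP => k.
rewrite mem_iota /= => /andP[lk _]; apply/negP => /andP[sV _].
have diag : (pipe_state V r k).1.2 - (pipe_state V r k).1.1 = 1 - r%:Z + k%:Z.
  rewrite /pipe_state; elim: k {lk sV} => [|k IH] /=; first by lia.
  case: (iter _ _ _) IH => [[a c] b] /= IH; case: ifP => _; case: b => /=; lia.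
move: sV diag; case: (pipe_state V r k).1 => a c sV /= diag.
have a0 : 0 < a by exact: (posV _ sV).
have : (absz c <= \max_(t <- V) absz t.2)%N.
  exact: (@leq_bigmax_seq _ _ xpredT (fun t : tile => absz t.2) _ sV).
by move: lk; rewrite /pipe_length; lia.
Qed.

Definition tab (m : nat) (V : {fset tile}) : tableau :=
  [seq row <- [seq pipe_row V r | r <- rev (iota 1 m)] | row != [::]].

Definition ins m n (A : 'M[bool]_(m, n)) : tableau :=
  tab m (rect_black (spd_of_matrix A)).

Definition tableau_shape (T : tableau) : seq nat := [seq size row | row <- T].

Definition conj_partition (sh : seq nat) : seq nat :=
  [seq count (fun l => j < l)%N sh | j <- iota 0 (head 0%N sh)].

Definition suffix_index n i (c : 'I_(n - i)) : 'I_n :=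
  Ordinal (etrans (esym (ltn_subRL i c n)) (ltn_ord c)).

(* The columns of A with (0-based) indices i, ..., n-1. *)
Definition suffix_mx m n (A : 'M[bool]_(m, n)) (i : nat) : 'M[bool]_(m, n - i) :=
  \matrix_(r, c) A r (suffix_index c).

Definition in_tableau (T : tableau) (p q : nat) : bool :=
  (q < size (nth [::] T p))%N.
Definition entry (T : tableau) (p q : nat) : nat := nth 0%N (nth [::] T p) q.

(* The filling of the diagram sh that agrees with T on the boxes of T and is v
   on the other boxes. *)
Definition extend_tableau (v : nat) (sh : seq nat) (T : tableau) : tableau :=
  [seq [seq (if in_tableau T p q then entry T p q else v)
          | q <- iota 0 (nth 0%N sh p)]
     | p <- iota 0 (size sh)].

(* T_{i+1} is obtained from T_{i+2}, starting with the empty tableau T_{n+1}. *)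
Definition rec m n (A : 'M[bool]_(m, n)) : tableau :=
  foldr (fun i T =>
      extend_tableau i.+1 (conj_partition (tableau_shape (ins (suffix_mx A i)))) T)
    [::] (iota 0 n).

(* Columns are numbered from 0. *)
Definition column (T : tableau) (q : nat) : seq nat :=
  [seq nth 0%N row q | row <- T & (q < size row)%N].

(* The tableau with the given columns when their sizes are weakly decreasing. *)
Definition tableau_of_columns (cols : seq (seq nat)) : tableau :=
  [seq [seq nth 0%N c p | c <- cols & (p < size c)%N]
     | p <- iota 0 (\max_(c <- cols) size c)].

Definition complement (m n : nat) (T : tableau) : tableau :=
  tableau_of_columns
    [seq [seq x <- rev (iota 1 n) | x \notin column T (m - q)] | q <- iota 1 m].

(* Main.v *)
(** A partition whose diagram fits in a box is encoded by its boundary word, a 0/1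
    word with a 1 for each row and a 0 for each column of the box.  To the submatrix of A
    formed by its last k rows and last d columns one attaches a word [growth k d] with k
    ones and d zeros, computed from the three smaller corners by a local rule [corner].
    - Flow.  Processing a column pair is one upward scan with a one-bit carry.  The red
      checkers of each column of A travel as a wave, one column per application of Y^+,
      and the state of the wave in a given row is exactly the state of the local rule
      reading its words from left to right ([cell_wave]).  Hence the black component of
      Rect(A) is read off the words [growth k n], and the pipes follow their ones.
    - Duality.  The local rule is invariant under exchanging 0 and 1, transposing the
      square and complementing the matrix entry.  So the words of the transpose-complement
      are the bitwise complements of those of A ([growth_dual]), which means that its
      shapes are the conjugate complements of the shapes of A. *)
Require Import Defs.
From mathcomp Require Import all_boot all_order all_algebra finmap.
From mathcomp Require Import zify.

Section SuperPipeDreams.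

Set Implicit Arguments.
Unset Strict Implicit.

(** * Boundary words and the local growth rule *)

Definition compl (w : nat -> bool) (x : nat) : bool := ~~ w x.

Lemma complE w x : compl w x = ~~ w x. Proof. by []. Qed.

(* The excess of ones of z over ones of w among the positions below x, provided that
   w and z are interlaced (ones_lag). *)
Fixpoint lag (w z : nat -> bool) (x : nat) : bool :=
  if x is y.+1 then ~~ w y && (lag w z y || z y) else false.

Lemma lagS w z x : lag w z x.+1 = ~~ w x && (lag w z x || z x).
Proof. by []. Qed.

(* z is the boundary word of a partition with one more row, obtained from that of w by
   adding a horizontal strip.  Complementing both words turns this into adding a column
   and a vertical strip. *)
Definition interlaced (w z : nat -> bool) : Prop :=
  forall x, if lag w z x then ~~ z x else w x ==> z x.

(* The boxes of the horizontal strip. *)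
Definition blank (w z : nat -> bool) (x : nat) : bool :=
  [&& ~~ lag w z x, ~~ w x & ~~ z x].

(* Remembers which of the two lags was positive last; initially the matrix entry. *)
Fixpoint pending (a : bool) (w z w' : nat -> bool) (x : nat) : bool :=
  if x is y.+1 then
    ~~ lag w z x && (lag (compl w) (compl w') x || pending a w z w' y)
  else a.

(* d and e are the lags of the two output pairs (w', z') and (compl z, compl z'). *)
Definition corner_bit (d e z w' a : bool) : bool :=
  ~~ d && (e || (if z == w' then z else ~~ a)).

Fixpoint corner_lags (a z w' : nat -> bool) (x : nat) : bool * bool :=
  if x is y.+1 then
    let: (d, e) := corner_lags a z w' y in
    let b := corner_bit d e (z y) (w' y) (a y) in
    (~~ w' y && (d || b), z y && (e || ~~ b))
  else (false, false).

Definition corner (a : bool) (w z w' : nat -> bool) (x : nat) : bool :=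
  let: (d, e) := corner_lags (pending a w z w') z w' x in
  corner_bit d e (z x) (w' x) (pending a w z w' x).

(** The bit at a position depends on lags of the word being built, so [corner] carries its own lags
    along; they turn out to be the true ones. The resulting fixed-point equation [cornerE] is the
    form in which the rule is used from then on. *)
Lemma corner_lagsE a w z w' x :
  corner_lags (pending a w z w') z w' x =
  (lag w' (corner a w z w') x, lag (compl z) (compl (corner a w z w')) x).
Proof.
elim: x => //= x IH; rewrite !complE negbK /corner IH /=.
by case: (lag w' _ x).
Qed.

Lemma cornerE a w z w' x :
  corner a w z w' x =
  corner_bit (lag w' (corner a w z w') x)
    (lag (compl z) (compl (corner a w z w')) x) (z x) (w' x) (pending a w z w' x).
Proof. by rewrite {1}/corner corner_lagsE. Qed.

Lemma lag_excl w z w' x : ~~ (lag w z x && lag (compl w) (compl w') x).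
Proof. by case: x => //= x; rewrite !complE negbK; case: (w x); rewrite //= andbF. Qed.

(** Passing from [w] to the fourth corner through [z] or through [w'] changes the number of ones by
    the same amount, so the two input lags and the two output lags have equal sums. As each pair is
    exclusive, the disjunctions agree. *)
Lemma corner_lag_or a w z w' x :
  interlaced w z -> interlaced (compl w) (compl w') ->
  (lag w' (corner a w z w') x || lag (compl z) (compl (corner a w z w')) x =
   lag w z x || lag (compl w) (compl w') x) /\
  ~~ (lag w' (corner a w z w') x && lag (compl z) (compl (corner a w z w')) x).
Proof.
move=> iz iw /=; elim: x => //= x.
move: (iz x) (iw x) (lag_excl w z w' x).
rewrite !complE !negbK (cornerE a w z w' x) /corner_bit.
set z' := corner a w z w'.
case: (lag w z x) (lag _ (compl w') x) => [] [] //;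
 case: (lag _ z' x) (lag _ (compl z') x) => [] [] //;
 case: (w x) (z x) (w' x) (pending a w z w' x) => [] [] [] [] /=; by move=> ? ? ? [].
Qed.

Lemma interlaced_corner a w z w' :
  interlaced w z -> interlaced (compl w) (compl w') ->
  interlaced w' (corner a w z w') /\ interlaced (compl z) (compl (corner a w z w')).
Proof.
move=> iz iw; split=> x; move: (iz x) (iw x) (lag_excl w z w' x);
  have := corner_lag_or a x iz iw;
  rewrite !complE (cornerE a w z w' x) /corner_bit;
  set z' := corner a w z w';
case: (lag w z x) (lag _ (compl w') x) => [] [] //;
 case: (lag _ z' x) (lag _ (compl z') x) => [] [] //;
 case: (w x) (z x) (w' x) (pending a w z w' x) => [] [] [] [] /=; by move=> [? ?] ? ? ?.
Qed.

(* One step of the upward scan of columns i and i+1.  The carry c tells whether a red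
   checker is in flight; bl and yl tell whether the left tile holds a black, respectively
   red checker, and br whether the right tile holds a black one. *)
Definition cell_carry (c bl yl br : bool) : bool :=
  if c then bl || yl else yl && ~~ br.
Definition cell_swap (c bl yl br : bool) : bool :=
  if c then bl || yl else yl && br.
Definition cell_left (c bl yl br : bool) : bool :=
  if cell_swap c bl yl br then br else bl.
Definition cell_right (c bl yl br : bool) : bool :=
  if cell_swap c bl yl br then bl else br.
Definition cell_red (c bl yl br : bool) : bool :=
  if c then yl || ~~ bl else yl && br.

(** State of one tile of a wave after x applications of $Y^+$: empty while a lag is positive,
    otherwise holding a black or a red checker according to [pending]. For x = 0 this is the matrix
    entry. *)
Definition idle (w z w' : nat -> bool) (x : nat) : bool :=
  ~~ (lag w z x || lag (compl w) (compl w') x).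

Definition wave_black (a : bool) (w z w' : nat -> bool) (x : nat) : bool :=
  idle w z w' x && pending a w z w' x.
Definition wave_red (a : bool) (w z w' : nat -> bool) (x : nat) : bool :=
  idle w z w' x && ~~ pending a w z w' x.

Lemma cell_wave a w z w' x :
  interlaced w z -> interlaced (compl w) (compl w') ->
  let z' := corner a w z w' in
  let c := blank (compl w) (compl w') x in
  let bl := wave_black a w z w' x in
  let yl := wave_red a w z w' x in
  let br := blank w z x in
  [/\ cell_carry c bl yl br = blank (compl z) (compl z') x,
      cell_left c bl yl br = blank w' z' x,
      cell_right c bl yl br = wave_black a w z w' x.+1 &
      cell_red c bl yl br = wave_red a w z w' x.+1].
Proof.
move=> iz iw /=; move: (iz x) (iw x) (lag_excl w z w' x).
have := corner_lag_or a x iz iw.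
(* A positive lag determines the pending bit. With this, interlacing and [corner_lag_or], the claim
   is a finite check on bits. *)
have PS : lag w z x -> pending a w z w' x = false by case: (x) => //= y ->.
have PT : lag (compl w) (compl w') x -> pending a w z w' x.
  case: (x) (lag_excl w z w' x) => // y ex e.
  change (~~ lag w z y.+1 && (lag (compl w) (compl w') y.+1 || pending a w z w' y)).
  by move: ex; rewrite e andbT => ->.
rewrite /wave_black /wave_red /idle /cell_carry /cell_left /cell_right /cell_red /cell_swap.
rewrite /blank /=.
rewrite !complE (cornerE a w z w' x) /corner_bit !negbK;
  set z' := corner a w z w'.
move: PS PT.
case: (lag w z x) (lag _ (compl w') x) => [] [] //;
 case: (lag _ z' x) (lag _ (compl z') x) => [] [] //; 
 case: (w x) (z x) (w' x) (pending a w z w' x) => [] [] [] [] //= P1 P2 [? ?] ? ? ?;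
 try (by split); try (by have := P1 isT); try (by have := P2 isT).
Qed.

(* Rows and columns are counted from the bottom right corner of the matrix.  Words are
   extended by false beyond their length k + d. *)
Fixpoint growth (B : nat -> nat -> bool) (k : nat) : nat -> nat -> bool :=
  if k is k'.+1 then
    fix growth_row (d : nat) : nat -> bool :=
      if d is d'.+1 then
        corner (B k' d') (growth B k' d') (growth_row d') (growth B k' d'.+1)
      else fun x => x < k'.+1
  else fun _ _ => false.

Lemma growth0 B d : growth B 0 d = fun=> false. Proof. by []. Qed.
Lemma growthn0 B k x : growth B k 0 x = (x < k). Proof. by case: k. Qed.
Lemma growthSS B k d :
  growth B k.+1 d.+1 =
  corner (B k d) (growth B k d) (growth B k.+1 d) (growth B k d.+1).
Proof. by []. Qed.

Lemma lag_eq w z w1 z1 x : (forall y, y < x -> w y = w1 y) ->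
  (forall y, y < x -> z y = z1 y) -> lag w z x = lag w1 z1 x.
Proof.
elim: x => //= x IH Hw Hz; rewrite Hw // Hz // IH // => y yx;
  [apply: Hw | apply: Hz]; exact: ltnW.
Qed.

Lemma lag_growthn0 B k x : lag (growth B k 0) (growth B k.+1 0) x = (k < x).
Proof.
elim: x => //= x ->; rewrite growthn0 -leqNgt ltnS (ltnS k x).
by case: ltngtP.
Qed.

Lemma lag_growth0 B d x :
  lag (compl (growth B 0 d)) (compl (growth B 0 d.+1)) x = false.
Proof. by case: x. Qed.

(** [interlaced_corner] passes interlacing from two sides of a square to the opposite two, so only
    the sides on the boundary of the grid need a direct argument. *)
Lemma interlaced_growth B k d :
  interlaced (growth B k d) (growth B k.+1 d) /\
  interlaced (compl (growth B k d)) (compl (growth B k d.+1)).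
Proof.
elim: k d => [|k IH] d.
  split=> [x|x]; last by rewrite lag_growth0.
  elim: d x => [|d IHd] x.
    by rewrite lag_growthn0 growthn0; case: x.
  rewrite growthSS.
  have iw : interlaced (compl (growth B 0 d)) (compl (growth B 0 d.+1)).
    by move=> y; rewrite lag_growth0.
  by have [] := interlaced_corner (B 0 d) (IHd : interlaced _ _) iw.
elim: d => [|d [IH1 IH2]]; last first.
  have i1 : interlaced (growth B k.+1 d.+1) (growth B k.+2 d.+1).
    by rewrite growthSS; case: (interlaced_corner (B k.+1 d) IH1 IH2).
  split=> //.
  have [j1 _] := IH d.+1; have [_ j2] := IH d.+1.
  by rewrite growthSS; case: (interlaced_corner (B k d.+1) j1 j2).
have [j1 j2] := IH 0.
split; last by rewrite growthSS; case: (interlaced_corner (B k 0) j1 j2).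
by move=> x; rewrite lag_growthn0 !growthn0; case: ltnP => h; [lia | apply/implyP; lia].
Qed.

(** Past the end, the extra one of the word with [k.+1] ones has already been read, so its lag stays
    positive and forces the bit to be false. The two claims feed each other across a square, hence
    the joint induction. *)
Lemma growth_tail B k d :
  (forall x, k + d <= x -> growth B k d x = false) /\
  (forall x, k + d < x -> lag (growth B k d) (growth B k.+1 d) x).
Proof.
have step k' d' :
  (forall x, k' + d' < x -> lag (growth B k' d') (growth B k'.+1 d') x) ->
  (forall x, k' + d'.+1 <= x -> growth B k' d'.+1 x = false) ->
  forall x, k'.+1 + d'.+1 <= x -> lag (growth B k' d'.+1) (growth B k'.+1 d'.+1) x
    /\ growth B k'.+1 d'.+1 x = false.
  move=> lag_d tail_d x lx.
  have lagx : lag (growth B k' d'.+1) (growth B k'.+1 d'.+1) x.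
    have [j1 j2] := interlaced_growth B k' d'.
    case: x lx => // x lx; rewrite lagS growthSS cornerE /corner_bit tail_d; last lia.
    case: (lag _ (corner _ _ _ _) x) (corner_lag_or (B k' d') x j1 j2) => //= - [].
    by rewrite lag_d; [move=> -> | lia].
  by split=> //; rewrite growthSS cornerE -growthSS lagx.
elim: k d => [|k IH] d.
  split=> //; elim: d => [|d IHd] x dx; first by rewrite lag_growthn0.
  by have [] // := step 0 d IHd _ x.
split.
  case: d => [|d] x dx; first by rewrite growthn0; lia.
  by have [] := step k d (IH d).2 (IH d.+1).1 x dx.
elim: d => [|d IHd] x dx; first by rewrite lag_growthn0; lia.
have [||//] := step k.+1 d IHd _ x.
  by move=> y dy; have [] := step k d (IH d).2 (IH d.+1).1 y dy.
by [].
Qed.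

Definition ones (w : nat -> bool) (x : nat) : nat := count w (iota 0 x).

Lemma onesS w x : ones w x.+1 = ones w x + w x.
Proof. by rewrite /ones -addn1 iotaD count_cat /= addn0. Qed.

Lemma ones_lag w z x : interlaced w z -> ones z x = ones w x + lag w z x.
Proof.
move=> iz; elim: x => // x IH; rewrite !onesS IH /=.
by move: (iz x); case: (lag w z x); case: (w x); case: (z x) => //= _; lia.
Qed.

Lemma ones_compl w x : ones (compl w) x = x - ones w x.
Proof.
by have := count_predC w (iota 0 x); rewrite size_iota => {2}<-; rewrite addKn.
Qed.

Lemma ones_growth B k d x : k + d <= x -> ones (growth B k d) x = k.
Proof.
elim: k x => [|k IH] x kx; first by rewrite /ones count_pred0.
have [iz _] := interlaced_growth B k d.
rewrite (ones_lag x iz) IH; last lia.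
by have [_ ->] := growth_tail B k d; lia.
Qed.

(** * Duality of the growth words *)

Lemma pending_dual a w z w' u v v' L x :
  (forall y, y < L -> u y = ~~ w y) -> (forall y, y < L -> v y = ~~ w' y) ->
  (forall y, y < L -> v' y = ~~ z y) -> x <= L ->
  pending (~~ a) u v v' x = ~~ pending a w z w' x.
Proof.
move=> Hu Hv Hv'; elim: x => // x IH xL.
have E1 : lag u v x.+1 = lag (compl w) (compl w') x.+1.
  by apply: lag_eq => y yx; [apply: Hu | apply: Hv]; lia.
have E2 : lag (compl u) (compl v') x.+1 = lag w z x.+1.
  by apply: lag_eq => y yx; rewrite !complE ?Hu ?Hv' ?negbK //; lia.
have := lag_excl w z w' x.+1.
rewrite [pending (~~ a) _ _ _ _]/pending -/(pending _ _ _ _ _) -/lag.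
rewrite [pending a _ _ _ _]/pending -/(pending _ _ _ _ _) -/lag.
rewrite -/(lag u v x.+1) -/(lag w z x.+1) E1 E2 IH; last lia.
by case: (lag w z _); case: (lag _ _ _) => //=; case: (pending _ _ _ _ _).
Qed.

Lemma corner_bit_dual d e z w' a : ~~ (d && e) ->
  corner_bit e d (~~ w') (~~ z) (~~ a) = ~~ corner_bit d e z w' a.
Proof. by case: d e z w' a => [] [] [] [] []. Qed.

(** Complementing and transposing exchanges the two lags of the output. These lags involve output
    bits at smaller positions, hence strong induction on the position. *)
Lemma corner_dual a w z w' u v v' L :
  interlaced w z -> interlaced (compl w) (compl w') ->
  (forall y, y < L -> u y = ~~ w y) -> (forall y, y < L.+1 -> v y = ~~ w' y) ->
  (forall y, y < L.+1 -> v' y = ~~ z y) ->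
  forall x, x < L.+1 -> corner (~~ a) u v v' x = ~~ corner a w z w' x.
Proof.
move=> iz iw Hu Hv Hv'; elim/ltn_ind => x IH xL.
have [_ ex] := corner_lag_or a x iz iw.
rewrite cornerE Hv // Hv' // (pending_dual a (L := L) Hu (w' := w') (z := z)); try lia.
- rewrite [in RHS]cornerE -corner_bit_dual //; congr corner_bit; apply: lag_eq => y yx.
  + by rewrite complE Hv' //; lia.
  + by rewrite complE IH //; lia.
  + by rewrite complE Hv ?negbK //; lia.
  + by rewrite complE IH ?negbK //; lia.
- by move=> y yL; apply: Hv; lia.
- by move=> y yL; apply: Hv'; lia.
Qed.

Lemma growth_dual B B' k d : (forall i j, B' j i = ~~ B i j) ->
  forall x, x < k + d -> growth B' d k x = ~~ growth B k d x.
Proof.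
move=> BB; elim: k d => [|k IH] d.
  by move=> x xd; rewrite growthn0 growth0 xd.
elim: d => [|d IHd] x xL; first by rewrite growth0 growthn0; lia.
have [j1 j2] := interlaced_growth B k d.
have [i1 i2] := interlaced_growth B' d k.
have Hu y : y < k + d -> growth B' d k y = ~~ growth B k d y by exact: IH.
have Hv y : y < (k + d).+1 -> growth B' d.+1 k y = ~~ growth B k d.+1 y.
  by move=> yL; apply: IH; lia.
have Hv' y : y < (k + d).+1 -> growth B' d k.+1 y = ~~ growth B k.+1 d y.
  by move=> yL; apply: IHd; lia.
have C := corner_dual (B k d) j1 j2 Hu Hv Hv'.
case: (ltnP x (k + d).+1) => xkd.
  by rewrite growthSS BB C.
(* Last position: the side words have ended and are extended by false on both sides of the duality,
   so they are not complementary here and [corner_dual] does not apply. Exactly one output lag is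
   positive, and it decides the bit alone. *)
have -> : x = (k + d).+1 by lia.
have [or ex] := corner_lag_or (B k d) (k + d).+1 j1 j2.
have E1 : lag (growth B' d k.+1) (growth B' d.+1 k.+1) (k + d).+1 =
          lag (compl (growth B k.+1 d)) (compl (growth B k.+1 d.+1)) (k + d).+1.
  apply: lag_eq => y yL; rewrite complE; first by rewrite Hv'.
  by rewrite !growthSS BB C.
have E2 : lag (compl (growth B' d.+1 k)) (compl (growth B' d.+1 k.+1)) (k + d).+1 =
          lag (growth B k d.+1) (growth B k.+1 d.+1) (k + d).+1.
  apply: lag_eq => y yL; rewrite complE; first by rewrite Hv // negbK.
  by rewrite !growthSS BB C // negbK.
rewrite !growthSS in E1 E2 *; rewrite !cornerE E1 E2 !(proj1 (growth_tail _ _ _)); try lia.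
have [_ lagL] := growth_tail B k d.
move: or ex; rewrite (lagL _ (ltnSn _)) orTb /corner_bit eqxx !orbF.
by case: (lag _ _ _); case: (lag _ _ _).
Qed.

Lemma growth_ext B B' k d : (forall i j, i < k -> j < d -> B i j = B' i j) ->
  growth B k d = growth B' k d.
Proof.
elim: k d => [|k IH] d; first by [].
elim: d => [|d IHd] H; first by [].
rewrite !growthSS H // IHd ?IH // => i j ik jd; apply: H; lia.
Qed.

(** * One column of the flow as a scan *)

Section Flow.

Import Order.TTheory GRing.Theory Num.Theory.
Local Open Scope fset_scope.
Local Open Scope ring_scope.

Lemma flow_step_id i P : (forall r, (r, i) \notin red P) -> flow_step i P = P.
Proof.
move=> H; case: flow_stepP => // r.
  by rewrite (negbTE (H r)).
by move=> k push; rewrite (negbTE (H r)).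
Qed.

Lemma red_rowsP i P r : (r \in red_rows i P) = ((r, i) \in red P).
Proof.
apply/imfsetP/idP => [[[r' c] /= + ->]|rP].
  by rewrite !inE /= => /andP[+ /eqP<-].
by exists (r, i) => //; rewrite !inE /= rP eqxx.
Qed.

Lemma sort_red_rows i P r : (r, i) \in red P ->
  (forall s, (s, i) \in red P -> s <= r) ->
  exists s, sort (fun r s : int => s <= r) (red_rows i P) = r :: s.
Proof.
move=> rP rmax.
have memE s : (s \in sort (fun r s : int => s <= r) (red_rows i P)) = ((s, i) \in red P).
  by rewrite mem_sort red_rowsP.
have: sorted (fun r s : int => s <= r) (sort (fun r s : int => s <= r) (red_rows i P)).
  by apply: sort_sorted => x y; apply: le_total.
case: (sort _ _) memE => [|x l] memE srt; first by move: (memE r); rewrite rP.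
exists l; congr cons; apply/eqP; rewrite eq_le rmax -?memE ?mem_head //=.
move: rP; rewrite -memE inE => /orP[/eqP->//|].
move: srt; rewrite /= path_sortedE; last by move=> a b c' ab bc; apply: le_trans bc ab.
by move=> /andP[/allP H _] /H.
Qed.

(** The hypothesis keeps the destinations free, so the shift merges no two tiles and membership can
    be read backwards. *)
Lemma mem_move_right (S : {fset tile}) (i : int) (p : pred int) (t : tile) :
  (forall s, p s -> (s, i + 1) \notin S) ->
  (t \in [fset (if (x.2 == i) && p x.1 then (x.1, i + 1) else x) | x in S]) =
  if p t.1 then
    if t.2 == i then false else if t.2 == i + 1 then (t.1, i) \in S else t \in S
  else t \in S.
Proof.
move=> pS; apply/imfsetP/idP => [[[r c] /= xS ->]|].
  case: (boolP ((c == i) && p r)) => [/andP[/eqP ci pr]|] /=; last first.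
    rewrite negb_and /=; case: ifP => //= pr; rewrite orbF => /negbTE ->.
    by case: eqP => // ce; move: (pS _ pr); rewrite -ce xS.
  by rewrite pr eqxx -ci xS; case: eqP => //; lia.
case: t => r c /=; case: ifP => pr; last first.
  by move=> tS; exists (r, c) => //=; rewrite pr andbF.
case: eqP => // ci; case: eqP => [-> rS|_ tS].
  by exists (r, i) => //=; rewrite eqxx pr.
by exists (r, c) => //=; case: eqP ci.
Qed.

Lemma gap_gt0 P r i : (0 < gap P r i)%N.
Proof. by rewrite /gap; case: ex_minnP => k /andP[]. Qed.

Lemma gap_unoccupied P r i : unoccupied P (r - (gap P r i)%:Z, i).
Proof. by rewrite /gap; case: ex_minnP => k /andP[]. Qed.

Lemma gap_occupied P r i (l : nat) :
  (0 < l < gap P r i)%N -> ~~ unoccupied P (r - l%:Z, i).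
Proof.
rewrite /gap; case: ex_minnP => k _ kmin /andP[l0 lk].
by apply/negP => u; have := kmin l; rewrite l0 u => /(_ isT); lia.
Qed.

Section Step.

Variables (i : int) (P : super_pipe_dream) (r : int).
Hypotheses (rP : (r, i) \in red P) (rmax : forall s, (s, i) \in red P -> s <= r).

Lemma black_step_swap t : (r, i + 1) \in black P ->
  (t \in black (flow_step i P)) =
  if t == (r, i) then true else
  if t == (r, i + 1) then (r, i) \in black P else t \in black P.
Proof.
move=> bP; rewrite /flow_step; have [s ->] := sort_red_rows rP rmax; rewrite bP /=.
have ii : ((r, i + 1) == (r, i)) = false by rewrite xpair_eqE eqxx; lia.
apply/imfsetP/idP => [[x /= xP ->]|].
  case: (boolP ((r, i) \in black P)) => riP; rewrite ?andbF ?andbT.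
    by case: eqP => // _; case: eqP.
  case: (eqVneq x (r, i + 1)) => [_|xr]; rewrite ?eqxx //.
  by case: eqP => // _; rewrite (negbTE xr).
case: eqP => [-> _|tri].
  case: (boolP ((r, i) \in black P)) => riP.
    by exists (r, i) => //; rewrite eq_sym ii.
  by exists (r, i + 1) => //; rewrite eqxx.
case: eqP => [-> riP|tri1 tP].
  by exists (r, i + 1) => //; rewrite eqxx riP.
by exists t => //; case: eqP tri1.
Qed.

Lemma red_step_swap t : (r, i + 1) \in black P ->
  (t \in red (flow_step i P)) =
  (t != (r, i)) && ((t == (r, i + 1)) || (t \in red P)).
Proof.
move=> bP; rewrite /flow_step; have [s ->] := sort_red_rows rP rmax; rewrite bP /=.
have ii : ((r, i + 1) == (r, i)) = false by rewrite xpair_eqE eqxx; lia.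
apply/imfsetP/idP => [[x /= xP ->]|].
  case: (eqVneq x (r, i)) => [_|xr]; first by rewrite ii eqxx.
  by rewrite xr xP orbT.
case/andP=> tri /orP[/eqP->|tP]; first by exists (r, i) => //; rewrite eqxx.
by exists t => //; rewrite (negbTE tri).
Qed.

Let K := gap P r i.
Let inflight (s : int) := [&& r - K%:Z < s, s < r & unoccupied P (s, i + 1)].

Lemma black_step_push t : (r, i + 1) \notin black P ->
  (t \in black (flow_step i P)) =
  if inflight t.1 then
    if t.2 == i then false else if t.2 == i + 1 then (t.1, i) \in black P
    else t \in black P
  else t \in black P.
Proof.
move=> /negbTE bP; rewrite /flow_step; have [s ->] := sort_red_rows rP rmax; rewrite bP /=.
rewrite -mem_move_right //.
by move=> x /and3P[_ _ /andP[]].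
Qed.

Lemma red_step_push t : (r, i + 1) \notin black P ->
  (t \in red (flow_step i P)) =
  (t == (r - K%:Z, i + 1)) || (t != (r, i)) &&
  (if inflight t.1 then
    if t.2 == i then false else if t.2 == i + 1 then (t.1, i) \in red P
    else t \in red P
  else t \in red P).
Proof.
move=> /negbTE bP; rewrite /flow_step; have [s ->] := sort_red_rows rP rmax; rewrite bP /=.
transitivity ((t == (r - K%:Z, i + 1)) || (t \in [fset (if (x.2 == i) && inflight x.1
   then (x.1, i + 1) else x) | x in red P `\ (r, i)])).
  apply/imfsetP/orP => [[x /= xP ->]|[/eqP->|]].
  - case: (eqVneq x (r, i)) => [_|xr]; first by left.
    by right; apply/imfsetP; exists x => //=; rewrite !inE xr.
  - by exists (r, i) => //; rewrite eqxx.
  - move=> /imfsetP[x /=]; rewrite !inE => /andP[xr xP ->].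
    by exists x => //; rewrite (negbTE xr).
rewrite mem_move_right; last first.
  by move=> x /and3P[_ _ /andP[_ h]]; rewrite !inE negb_and h orbT.
congr orb; rewrite !inE; case: t => u c /=.
case: ifP => // fl; rewrite !xpair_eqE.
have -> : (u == r) = false by move: fl => /and3P[]; lia.
by rewrite /=.
Qed.

End Step.

Section Scan.

Variables (M i : int).

Implicit Type P : super_pipe_dream.

Notation bl P k := ((M - k%:Z, i) \in black P).
Notation yl P k := ((M - k%:Z, i) \in red P).
Notation br P k := ((M - k%:Z, i + 1) \in black P).
Notation yr P k := ((M - k%:Z, i + 1) \in red P).

Fixpoint scan_carry P (k : nat) : bool :=
  if k is l.+1 then cell_carry (scan_carry P l) (bl P l) (yl P l) (br P l) else false.

Definition scan_left P k := cell_left (scan_carry P k) (bl P k) (yl P k) (br P k).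
Definition scan_right P k := cell_right (scan_carry P k) (bl P k) (yl P k) (br P k).
Definition scan_red P k :=
  yr P k || cell_red (scan_carry P k) (bl P k) (yl P k) (br P k).

(** Rows increase downwards: no checker lies lower than row M, so the upward scan may start there
    without a carry. *)
Definition below_top P := forall t, t \in black P `|` red P -> t.1 <= M.

(* Excludes a red checker from taking off below one that has already landed. *)
Definition landing_clear P := forall r s, (r, i) \in red P ->
  (r, i + 1) \notin black P -> s <= r -> (s, i + 1) \notin red P.

Lemma scan_carry_no_red P k : (forall l, (l < k)%N -> ~~ yl P l) -> scan_carry P k = false.
Proof.
elim: k => //= k IH H; rewrite IH ?(negbTE (H k _)) // => l lk.
by apply: H; lia.
Qed.

(** The scan predicts the outcome of the whole column operator. One round of the procedure leaves
    the prediction unchanged, and once column i has no red checker the prediction is the actual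
    position. *)
Record scan_invariant P P' : Prop := ScanInvariant {
  scan_leftE : forall k, scan_left P' k = scan_left P k;
  scan_rightE : forall k, scan_right P' k = scan_right P k;
  scan_redE : forall k, scan_red P' k = scan_red P k;
  other_columns : forall t, t.2 != i -> t.2 != i + 1 ->
    ((t \in black P') = (t \in black P)) /\ ((t \in red P') = (t \in red P));
  still_below_top : below_top P';
  still_clear : landing_clear P' }.

(** Only the row of the lowest red checker changes. The carry reaching it is false, since no red
    checker lies lower, and the cell rule makes exactly this exchange and again emits no carry. *)
Lemma scan_step_swap P r : below_top P -> landing_clear P ->
  (r, i) \in red P -> (forall s, (s, i) \in red P -> s <= r) ->
  (r, i + 1) \in black P -> scan_invariant P (flow_step i P).
Proof.
move=> top clear rP rmax bP.
have blE := black_step_swap rP rmax ^~ bP.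
have rdE := red_step_swap rP rmax ^~ bP.
have rM : r <= M by apply: (top (r, i)); rewrite inE rP orbT.
have [k0 k0E] : exists k0 : nat, r = M - k0%:Z by exists (absz (M - r)); lia.
have blk k : bl (flow_step i P) k = (k == k0) || bl P k.
  rewrite blE !xpair_eqE eqxx andbT; have -> : (i == i + 1) = false by lia.
  rewrite andbF; have -> : (M - k%:Z == r) = (k == k0) by lia.
  by case: (k == k0).
have ylk k : yl (flow_step i P) k = (k != k0) && yl P k.
  rewrite rdE !xpair_eqE eqxx andbT; have -> : (i == i + 1) = false by lia.
  by rewrite andbF; have -> : (M - k%:Z == r) = (k == k0) by lia.
have brk k : br (flow_step i P) k = if k == k0 then bl P k else br P k.
  rewrite blE !xpair_eqE eqxx andbT; have -> : (i + 1 == i) = false by lia.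
  rewrite andbF; have -> : (M - k%:Z == r) = (k == k0) by lia.
  by case: eqP => // ->; rewrite k0E.
have yrk k : yr (flow_step i P) k = (k == k0) || yr P k.
  rewrite rdE !xpair_eqE eqxx andbT; have -> : (i + 1 == i) = false by lia.
  by rewrite andbF; have -> : (M - k%:Z == r) = (k == k0) by lia.
have cP0 : scan_carry P k0 = false.
  apply: scan_carry_no_red => l lk; apply/negP => /rmax; lia.
have cE k : scan_carry (flow_step i P) k = scan_carry P k.
  elim: k => //= k ->; rewrite blk ylk brk.
  by case: eqP => //= ->; rewrite cP0 -k0E rP bP.
split.
- move=> k; rewrite /scan_left cE blk ylk brk.
  by case: eqP => //= ->; rewrite cP0 -k0E rP bP.
- move=> k; rewrite /scan_right cE blk ylk brk.
  by case: eqP => //= ->; rewrite cP0 -k0E rP bP.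
- move=> k; rewrite /scan_red cE blk ylk brk yrk.
  by case: eqP => //= ->; rewrite cP0 -k0E rP bP /= orbT.
- move=> [u c] /= ci ci1; rewrite blE rdE !xpair_eqE (negbTE ci) (negbTE ci1).
  by rewrite !andbF.
- move=> t; rewrite inE blE rdE.
  case: eqP => [-> //|_]; case: eqP => [-> //|_] /= tP.
  by apply: top; rewrite inE.
- move=> s u; rewrite rdE => /andP[sr]; rewrite !xpair_eqE.
  have -> : (i == i + 1) = false by lia.
  rewrite andbF /= => sP; rewrite blE !xpair_eqE.
  have -> : (i + 1 == i) = false by lia.
  have sr' : s < r by move: (rmax _ sP) sr; rewrite xpair_eqE eqxx; lia.
  have -> : (s == r) = false by lia.
  rewrite andbF /= => bs us; rewrite rdE !xpair_eqE.
  have -> : (u == r) = false by lia.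
  by rewrite !andFb /=; apply: clear bs us.
Qed.

(** Before the round the scan carries a checker from row [k0] to the landing row [k0 + K]; after it,
    the scan crosses these rows without carry. In each row, the cell rule with carry on the old
    contents agrees with the rule without carry on the pushed contents. *)
Lemma scan_step_push P r : below_top P -> landing_clear P ->
  (r, i) \in red P -> (forall s, (s, i) \in red P -> s <= r) ->
  (r, i + 1) \notin black P -> scan_invariant P (flow_step i P).
Proof.
move=> top clear rP rmax bP.
have blE := black_step_push rP rmax ^~ bP.
have rdE := red_step_push rP rmax ^~ bP.
have gap0 := gap_gt0 P r i; have gapU := gap_unoccupied P r i.
have gapO := @gap_occupied P r i.
move: (gap P r i) gap0 gapU gapO blE rdE => K K0 gapU gapO blE rdE.
have rM : r <= M by apply: (top (r, i)); rewrite inE rP orbT.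
have [k0 k0E] : exists k0 : nat, r = M - k0%:Z by exists (absz (M - r)); lia.
have yr0 k : (k0 <= k)%N -> yr P k = false.
  by move=> kk; apply/negbTE/(clear r) => //; lia.
(* The rows that are pushed to the right. By [landing_clear] their right tiles hold no red checker,
   so only black ones have to be excluded. *)
pose fl k := [&& (k0 < k)%N, (k < k0 + K)%N & ~~ br P k].
have flE k : [&& r - K%:Z < M - k%:Z, M - k%:Z < r & unoccupied P (M - k%:Z, i + 1)] = fl k.
  rewrite /fl /unoccupied.
  have -> : (M - k%:Z < r) = (k0 < k)%N by lia.
  have -> : (r - K%:Z < M - k%:Z) = (k < k0 + K)%N by lia.
  by case: (ltnP k0 k) => [kk|]; rewrite ?andbF ?yr0 ?andbT //; lia.
have fl_out k : (k <= k0)%N || (k0 + K <= k)%N -> fl k = false.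
  by rewrite /fl => /orP[]; rewrite leqNgt => /negbTE->; rewrite ?andbF.
have ii1 : (i == i + 1) = false by lia.
have i1i : (i + 1 == i) = false by lia.
have blk k : bl (flow_step i P) k = ~~ fl k && bl P k.
  by rewrite blE /= flE eqxx; case: (fl k).
have ylk k : yl (flow_step i P) k = [&& k != k0, ~~ fl k & yl P k].
  rewrite rdE /= flE !xpair_eqE eqxx ii1 andbF andbT /=.
  have -> : (M - k%:Z == r) = (k == k0) by lia.
  by case: (fl k).
have brk k : br (flow_step i P) k = if fl k then bl P k else br P k.
  by rewrite blE /= flE eqxx i1i.
have yrk k : yr (flow_step i P) k = (k == (k0 + K)%N) || (if fl k then yl P k else yr P k).
  rewrite rdE /= flE !xpair_eqE eqxx i1i andbF andbT /=.
  by have -> : (M - k%:Z == r - K%:Z) = (k == (k0 + K)%N) by lia.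
have yl_low k : (k < k0)%N -> yl P k = false.
  by move=> kk; apply/negP => /rmax; lia.
have occ k : (k0 < k < k0 + K)%N -> bl P k || yl P k.
  move=> kk; have := gapO (k - k0)%N; rewrite /unoccupied.
  have -> : r - (k - k0)%N%:Z = M - k%:Z by lia.
  by move/(_ ltac:(lia)); case: (bl P k); case: (yl P k).
have free : ~~ bl P (k0 + K)%N && ~~ yl P (k0 + K)%N.
  by have -> : M - (k0 + K)%N%:Z = r - K%:Z by lia.
have cP_low k : (k <= k0)%N -> scan_carry P k = false.
  by move=> kk; apply: scan_carry_no_red => l lk; rewrite yl_low //; lia.
have rk0 : yl P k0 by rewrite -k0E.
have bk0 : ~~ br P k0 by rewrite -k0E.
have cP_mid k : (k0 < k <= k0 + K)%N -> scan_carry P k.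
  elim: k => // k IH; rewrite ltnS => /andP[k0k kK] /=.
  case: (ltngtP k0 k) k0k => // [k0k _|<- _].
    by rewrite IH ?k0k /= ?occ ?k0k //; lia.
  by rewrite cP_low // /= rk0 bk0.
(* After the round nothing takes off up to the landing row: a red checker left there has a black
   right neighbour. *)
have quiet k : (k <= k0 + K)%N ->
    yl (flow_step i P) k && ~~ br (flow_step i P) k = false.
  move=> kk; rewrite ylk brk /fl.
  case: (ltngtP k k0) => [/yl_low->|k0k|->]; rewrite ?andbF //=.
  case: (ltngtP k (k0 + K)%N) kk => // [kK _|-> _] /=.
    by case: (br P k); rewrite ?andbF.
  by case/andP: free => _ /negbTE->.
have cP'_low k : (k <= (k0 + K).+1)%N -> scan_carry (flow_step i P) k = false.
  by elim: k => //= k IH kk; rewrite IH /= ?quiet //; lia.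
have cE k : (k0 + K < k)%N -> scan_carry (flow_step i P) k = scan_carry P k.
  elim: k => // k IH; rewrite ltnS leq_eqVlt => /orP[/eqP<-|kk].
    rewrite cP'_low //= cP_mid; last lia.
    by case/andP: free => /negbTE-> /negbTE->.
  rewrite /= IH // blk ylk brk.
  have -> : fl k = false by apply: fl_out; lia.
  by have -> : (k != k0) = true by lia.
have cell k : [/\ scan_left (flow_step i P) k = scan_left P k,
    scan_right (flow_step i P) k = scan_right P k &
    scan_red (flow_step i P) k = scan_red P k].
  rewrite /scan_left /scan_right /scan_red.
  case: (ltnP (k0 + K) k) => kK.
    rewrite cE // blk ylk brk yrk.
    have -> : fl k = false by apply: fl_out; lia.
    have -> : (k != k0) = true by lia.
    by have -> : (k == (k0 + K)%N) = false by lia.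
  rewrite cP'_low; last lia.
  rewrite blk ylk brk yrk.
  case: (ltngtP k k0) => [kk|kk|->] /=.
  - rewrite cP_low ?(ltnW kk) // yl_low //.
    have -> : fl k = false by apply: fl_out; lia.
    by have -> : (k == (k0 + K)%N) = false by lia.
  - rewrite cP_mid ?kk // yr0 ?(ltnW kk) //.
    case: (ltngtP k (k0 + K)%N) kK => // [kK _|-> _].
      rewrite /fl kk kK /=; have := occ k; rewrite kk kK => /(_ isT).
      by case: (bl P k); case: (yl P k); case: (br P k).
    have -> : fl (k0 + K)%N = false by apply: fl_out; lia.
    by case/andP: free => /negbTE-> /negbTE->; case: (br P _).
  - rewrite cP_low // rk0 (negbTE bk0) yr0 //.
    have -> : fl k0 = false by apply: fl_out; lia.
    have -> : (k0 == (k0 + K)%N) = false by lia.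
    by case: (bl P k0).
split.
- by move=> k; case: (cell k).
- by move=> k; case: (cell k).
- by move=> k; case: (cell k).
- move=> [u c] /= ci ci1; rewrite blE rdE /= !xpair_eqE (negbTE ci) (negbTE ci1).
  by rewrite !andbF /= !if_same.
- move=> [u c]; rewrite inE blE rdE /= => /orP[|/orP[]].
  + case: ifP => [_|_ tP]; last by apply: (top (u, c)); rewrite inE tP.
    case: ifP => // _; case: ifP => _ tP; last by apply: (top (u, c)); rewrite inE tP.
    by apply: (top (u, i)); rewrite inE tP.
  + by rewrite xpair_eqE => /andP[/eqP-> _]; lia.
  + case/andP=> _; case: ifP => [_|_ tP]; last by apply: (top (u, c)); rewrite inE tP orbT.
    case: ifP => // _; case: ifP => _ tP; last by apply: (top (u, c)); rewrite inE tP orbT.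
    by apply: (top (u, i)); rewrite inE tP orbT.
- move=> s u sP sB us.
  have sM : s <= M.
    move: sP; rewrite rdE xpair_eqE /= ii1 andbF /= => /andP[_].
    case: ifP => [|_ sP]; first by rewrite eqxx.
    by apply: (top (s, i)); rewrite inE sP orbT.
  have [ks ksE] : exists ks : nat, s = M - ks%:Z by exists (absz (M - s)); lia.
  have [ku kuE] : exists ku : nat, u = M - ku%:Z by exists (absz (M - u)); lia.
  rewrite {}ksE in sP sB us *; rewrite {}kuE in us *.
  case: (leqP ks (k0 + K)) => ksK.
    by have := quiet ks ksK; rewrite sP sB.
  rewrite yrk.
  have -> : (ku == (k0 + K)%N) = false by lia.
  have -> : fl ku = false by apply: fl_out; lia.
  by rewrite yr0 //; lia.
Qed.

Lemma scan_step P : below_top P -> landing_clear P ->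
  scan_invariant P (flow_step i P).
Proof.
move=> top clear; case E: (sort (fun r s : int => s <= r) (red_rows i P)) => [|r l].
  by rewrite /flow_step E; split.
have rP : (r, i) \in red P.
  by rewrite -red_rowsP -(mem_sort (fun r s : int => s <= r)) E mem_head.
have rmax s : (s, i) \in red P -> s <= r.
  rewrite -red_rowsP -(mem_sort (fun r s : int => s <= r)) E inE => /orP[/eqP->//|].
  have: sorted (fun r s : int => s <= r) (r :: l).
    by rewrite -E; apply: sort_sorted => x y; apply: le_total.
  rewrite /= path_sortedE; last by move=> a b c ab bc; apply: le_trans bc ab.
  by move=> /andP[/allP H _] /H.
by case: (boolP ((r, i + 1) \in black P)); [apply: scan_step_swap | apply: scan_step_push].
Qed.

Lemma Ycol_scan P : below_top P -> (forall r, (r, i + 1) \notin red P) ->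
  [/\ below_top (Ycol i P),
    forall k, [/\ bl (Ycol i P) k = scan_left P k, br (Ycol i P) k = scan_right P k,
      yl (Ycol i P) k = false & yr (Ycol i P) k = scan_red P k] &
    forall t, t.2 != i -> t.2 != i + 1 ->
      ((t \in black (Ycol i P)) = (t \in black P)) /\
      ((t \in red (Ycol i P)) = (t \in red P))].
Proof.
move=> top no_red; have clear : landing_clear P by move=> *; apply: no_red.
have: scan_invariant P (Ycol i P).
  rewrite /Ycol; elim: #|` red P| => [|n IH]; first by split.
  have IH2 := scan_step (still_below_top IH) (still_clear IH).
  rewrite iterS; split.
  - by move=> k; rewrite (scan_leftE IH2) (scan_leftE IH).
  - by move=> k; rewrite (scan_rightE IH2) (scan_rightE IH).
  - by move=> k; rewrite (scan_redE IH2) (scan_redE IH).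
  - move=> t ti ti1; have [-> ->] := other_columns IH2 ti ti1.
    exact: (other_columns IH).
  - exact: still_below_top IH2.
  - exact: still_clear IH2.
case=> leftE rightE redE others top' _; split=> // k.
have yl0 l : yl (Ycol i P) l = false.
  by apply/negP => /Ycol_no_red; rewrite eqxx.
have c0 : scan_carry (Ycol i P) k = false.
  by apply: scan_carry_no_red => l _; rewrite yl0.
have [L R D] := And3 (leftE k) (rightE k) (redE k).
move: L R D; rewrite /scan_left /scan_right /scan_red c0 yl0 => <- <- <-.
by rewrite /cell_left /cell_right /cell_red /= orbF.
Qed.

End Scan.

End Flow.

(** * Rectification *)

Section Rect.

Import Order.TTheory GRing.Theory Num.Theory.

Local Notation "n %:Z" := (Posz n) : nat_scope.

Variables (m n : nat) (B : nat -> nat -> bool).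

Notation g := (growth B).

Definition square_black (k e t : nat) : bool :=
  wave_black (B k e) (g k e) (g k.+1 e) (g k e.+1) t.
Definition square_red (k e t : nat) : bool :=
  wave_red (B k e) (g k e) (g k.+1 e) (g k e.+1) t.

(* The checkers after t applications of Y^+ and d further column operators.  Here k is a
   row counted from the bottom and j a column counted from 0 on the left; the wave of the
   e-th column of A from the right (e >= 0) is in column n - 1 - e + t, or one further
   if e < d. *)
Definition stage_black (t d k j : nat) : bool :=
  if j < t then blank (g k n) (g k.+1 n) j
  else if j < t + (n - d) then square_black k (n.-1 - (j - t)) t
  else if j == t + (n - d) then blank (g k d) (g k.+1 d) t
  else (j <= t + n) && square_black k (n - (j - t)) t.+1.

Definition stage_red (t d k j : nat) : bool :=
  if j < t then false
  else if j < t + (n - d) then square_red k (n.-1 - (j - t)) t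
  else if j == t + (n - d) then false
  else (j <= t + n) && square_red k (n - (j - t)) t.+1.

Notation tile_at k j := ((m%:Z - k%:Z)%R, (j.+1)%:Z).

(** Red checkers are located only in the rows of the matrix: no black checker lies above row 1 and
    the scan runs upwards, so those beyond the top cannot affect the rows below. [stage_red_cols]
    covers all rows because a column operator needs a target column free of red checkers. *)
Record at_stage (t d : nat) (Q : super_pipe_dream) : Prop := AtStage {
  stage_top : below_top m%:Z Q;
  stage_left : forall u, u \in (black Q `|` red Q)%fset -> (1 <= u.2)%R;
  stage_blackE : forall k j, (tile_at k j \in black Q) = (k < m) && stage_black t d k j;
  stage_redE : forall k j, k < m -> (tile_at k j \in red Q) = stage_red t d k j;
  stage_red_cols : forall (r : int) (j : nat), (r, (j.+1)%:Z) \in red Q ->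
    [&& t <= j, j != t + (n - d) & j <= t + n] }.

Lemma Ycol_id i P : (forall r, (r, i) \notin red P) -> Ycol i P = P.
Proof.
by move=> H; rewrite /Ycol; elim: #|` red P| => //= l ->; apply: flow_step_id.
Qed.

Lemma at_stage_Ycol t d Q : d < n -> at_stage t d Q ->
  at_stage t d.+1 (Ycol (t + (n - d))%:Z Q).
Proof.
move=> dn [top left blE rdE cols].
set i : int := (t + (n - d))%:Z.
have iE : i = (t + (n - d.+1)).+1%:Z by rewrite /i; lia.
have i1E : (i + 1)%R = (t + (n - d)).+1%:Z by rewrite /i; lia.
have no_red r : (r, (i + 1)%R) \notin red Q.
  by apply/negP; rewrite i1E => /cols; rewrite eqxx andbF.
have [top' colsE others] := Ycol_scan top no_red.
have blk k : ((m%:Z - k%:Z)%R, i) \in black Q = (k < m) && square_black k d t.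
  rewrite iE blE /stage_black; have -> : (t + (n - d.+1) < t) = false by lia.
  have -> : (t + (n - d.+1) < t + (n - d)) by lia.
  by have -> : n.-1 - (t + (n - d.+1) - t) = d by lia.
have ylk k : k < m -> ((m%:Z - k%:Z)%R, i) \in red Q = square_red k d t.
  move=> km; rewrite iE rdE // /stage_red; have -> : (t + (n - d.+1) < t) = false by lia.
  have -> : (t + (n - d.+1) < t + (n - d)) by lia.
  by have -> : n.-1 - (t + (n - d.+1) - t) = d by lia.
have brk k : ((m%:Z - k%:Z)%R, (i + 1)%R) \in black Q =
    (k < m) && blank (g k d) (g k.+1 d) t.
  rewrite i1E blE /stage_black; have -> : (t + (n - d) < t) = false by lia.
  by rewrite ltnn eqxx.
(* The carry is the vertical strip of the complemented words. It starts as false because the words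
   with no ones are constantly false. *)
have cE k : k <= m ->
    scan_carry m%:Z i Q k = blank (compl (g k d)) (compl (g k d.+1)) t.
  elim: k => [_|k IH km]; first by rewrite /blank !complE !growth0 andbF.
  rewrite /= IH ?blk ?ylk ?brk ?km //=; last lia.
  have [iz iw] := interlaced_growth B k d.
  by case: (cell_wave (B k d) t iz iw).
have cell k : k < m ->
  [/\ scan_left m%:Z i Q k = blank (g k d.+1) (g k.+1 d.+1) t,
      scan_right m%:Z i Q k = square_black k d t.+1 &
      scan_red m%:Z i Q k = square_red k d t.+1].
  move=> km; have [iz iw] := interlaced_growth B k d.
  rewrite /scan_left /scan_right /scan_red cE ?(ltnW km) // blk ylk // brk km.
  rewrite (negbTE (no_red _)) /=.
  by case: (cell_wave (B k d) t iz iw).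
split=> //.
- move=> [u c] tP /=.
  case: (eqVneq c i) => [->|ci]; first by rewrite iE.
  case: (eqVneq c (i + 1)%R) => [->|ci1]; first by rewrite i1E.
  apply: (left (u, c)); move: tP; rewrite !inE.
  by have [-> ->] := others (u, c) ci ci1.
(* Above row 1 neither tile holds a black checker, so none appears, whatever the carry. *)
- move=> k j; case: (ltnP k m) => km /=; last first.
    case: (eqVneq (j.+1)%:Z i) => [ji|ji].
      have [+ _ _ _] := colsE k; rewrite ji => ->.
      by rewrite /scan_left blk brk ltnNge km /cell_left if_same.
    case: (eqVneq (j.+1)%:Z (i + 1)%R) => [ji1|ji1].
      have [_ + _ _] := colsE k; rewrite ji1 => ->.
      by rewrite /scan_right blk brk ltnNge km /cell_right if_same.
    by have [-> _] := others (tile_at k j) ji ji1; rewrite blE ltnNge km.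
  have [L R _] := cell k km.
  case: (eqVneq (j.+1)%:Z i) => [ji|ji].
    have [+ _ _ _] := colsE k; rewrite ji => ->; rewrite L /stage_black.
    have -> : j = t + (n - d.+1) by lia.
    by rewrite ltnn eqxx ifF //; lia.
  case: (eqVneq (j.+1)%:Z (i + 1)%R) => [ji1|ji1].
    have [_ + _ _] := colsE k; rewrite ji1 => ->; rewrite R /stage_black.
    have -> : j = t + (n - d) by lia.
    have -> : (t + (n - d) < t) = false by lia.
    have -> : (t + (n - d) < t + (n - d.+1)) = false by lia.
    have -> : (t + (n - d) == t + (n - d.+1)) = false by lia.
    have -> : t + (n - d) <= t + n by lia.
    by have -> : n - (t + (n - d) - t) = d by lia.
  have [-> _] := others (tile_at k j) ji ji1; rewrite blE km /stage_black /=.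
  case: (ltnP j t) => // tj.
  have -> : (j < t + (n - d.+1)) = (j < t + (n - d)) by lia.
  case: ltnP => // jd.
  have -> : (j == t + (n - d)) = false by lia.
  by have -> : (j == t + (n - d.+1)) = false by lia.
- move=> k j km; have [_ _ R] := cell k km.
  case: (eqVneq (j.+1)%:Z i) => [ji|ji].
    have [_ _ + _] := colsE k; rewrite ji => ->; rewrite /stage_red.
    have -> : j = t + (n - d.+1) by lia.
    by rewrite ltnn eqxx if_same.
  case: (eqVneq (j.+1)%:Z (i + 1)%R) => [ji1|ji1].
    have [_ _ _] := colsE k; rewrite ji1 => ->; rewrite R /stage_red.
    have -> : j = t + (n - d) by lia.
    have -> : (t + (n - d) < t) = false by lia.
    have -> : (t + (n - d) < t + (n - d.+1)) = false by lia.
    have -> : (t + (n - d) == t + (n - d.+1)) = false by lia.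
    have -> : t + (n - d) <= t + n by lia.
    by have -> : n - (t + (n - d) - t) = d by lia.
  have [_ ->] := others (tile_at k j) ji ji1; rewrite rdE // /stage_red /=.
  case: (ltnP j t) => // tj.
  have -> : (j < t + (n - d.+1)) = (j < t + (n - d)) by lia.
  case: ltnP => // jd.
  have -> : (j == t + (n - d)) = false by lia.
  by have -> : (j == t + (n - d.+1)) = false by lia.
- move=> r j rP.
  have rM : (r <= m%:Z)%R by apply: (top' (r, (j.+1)%:Z)); rewrite inE rP orbT.
  case: (eqVneq (j.+1)%:Z i) => [ji|ji].
    have [k kE] : exists k : nat, r = (m%:Z - k%:Z)%R by exists (absz (m%:Z - r)); lia.
    by have [_ _ + _] := colsE k; rewrite -kE; rewrite ji in rP; rewrite rP.
  case: (eqVneq (j.+1)%:Z (i + 1)%R) => [ji1|ji1]; first by lia.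
  have [_ rE] := others (r, (j.+1)%:Z) ji ji1; move: rP; rewrite rE => /cols.
  lia.
Qed.

(** The list contains only columns with red checkers. [Ycol] is the identity on a skipped column, so
    the stage counter still advances there. *)
Lemma at_stage_foldl t d Q s : d <= n -> at_stage t d Q ->
  sorted (fun i j : int => j <= i)%R s -> uniq s ->
  (forall c, c \in s -> exists2 e, d <= e < n & c = (t + (n - e))%:Z) ->
  (forall r c, (r, c) \in red Q -> (c <= (t + (n - d))%:Z)%R -> c \in s) ->
  at_stage t n (foldl (fun Q i => Ycol i Q) Q s).
Proof.
move: {2}(n - d) (erefl (n - d)) => l; elim: l d Q s => [|l IH] d Q s nd dn QS srt un sE cov.
  have -> : s = [::].
    case: s sE {srt un cov} => // c s sE.
    by have [e] := sE c (mem_head _ _); lia.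
  by rewrite /= (_ : n = d) //; lia.
set c0 : int := (t + (n - d))%:Z.
have QS' := at_stage_Ycol (_ : d < n) QS.
have {}QS' := QS' ltac:(lia); rewrite -/c0 in QS'.
case: (boolP (c0 \in s)) => c0s; last first.
  have Qid : Ycol c0 Q = Q.
    by apply: Ycol_id => r; apply: contra c0s => /cov; apply.
  rewrite Qid in QS'.
  apply: (IH d.+1) => //; try lia.
    move=> c cs; have [e ed ce] := sE c cs; exists e => //.
    case: (eqVneq e d) => [ede|]; last lia.
    by move: c0s; rewrite /c0 -ede -ce cs.
  by move=> r c /cov H cle; apply: H; lia.
case: s srt un sE cov c0s => // c s srt un sE cov c0s.
have cc0 : c = c0.
  apply/eqP; rewrite eq_le; apply/andP; split.
    by have [e ed ->] := sE c (mem_head _ _); rewrite /c0; lia.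
  move: c0s; rewrite inE => /orP[/eqP->//|].
  move: srt; rewrite /= path_sortedE; last by move=> x y z xy yz; apply: le_trans yz xy.
  by move=> /andP[/allP H _] /H.
rewrite /= cc0; apply: (IH d.+1) => //; try lia.
- exact: path_sorted srt.
- by case/andP: un.
- move=> x xs; have [|e ed xe] := sE x; first by rewrite inE xs orbT.
  exists e => //; case: (eqVneq e d) => [ede|]; last lia.
  by move: un; rewrite /= cc0 /c0 -ede -xe xs.
- move=> r x; rewrite -/c0 => rP xle.
  have no_red r' : (r', (c0 + 1)%R) \notin red Q.
    have -> : (c0 + 1)%R = (t + (n - d)).+1%:Z by rewrite /c0; lia.
    by apply/negP => /(stage_red_cols QS); rewrite eqxx andbF.
  have [_ _ others] := Ycol_scan (stage_top QS) no_red.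
  have x1 : x != c0 by rewrite /c0; lia.
  have x2 : x != (c0 + 1)%R by rewrite /c0; lia.
  have [_ E] := others (r, x) x1 x2; move: rP; rewrite E => /cov.
  rewrite inE cc0 (negbTE x1) /=; apply; rewrite /c0 in xle *; lia.
Qed.

(** A change of indices: all waves have moved by one column, and the column they have just left
    becomes final. The column next to the rightmost wave is empty since the words for d = 0 have no
    common blank. *)
Lemma at_stage_next t Q : at_stage t n Q -> at_stage t.+1 0 Q.
Proof.
move=> [top left blE rdE cols]; split=> //.
- move=> k j; rewrite blE; congr andb; rewrite /stage_black subnn addn0 subn0.
  case: (ltngtP j t) => [jt|jt|->].
  + by have -> : j < t.+1 by lia.
  + have -> : (j < t.+1) = false by lia.
    case: (ltngtP j (t.+1 + n)) => jn.
    * have -> : j <= t + n by lia.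
      by have -> : n - (j - t) = n.-1 - (j - t.+1) by lia.
    * by have -> : (j <= t + n) = false by lia.
    * have -> : (j <= t + n) = false by lia.
      by rewrite /blank lag_growthn0 !growthn0; lia.
  + by rewrite ltnSn.
- move=> k j km; rewrite rdE //; rewrite /stage_red subnn addn0 subn0.
  case: (ltngtP j t) => [jt|jt|->].
  + by have -> : j < t.+1 by lia.
  + have -> : (j < t.+1) = false by lia.
    case: (ltngtP j (t.+1 + n)) => jn.
    * have -> : j <= t + n by lia.
      by have -> : n - (j - t) = n.-1 - (j - t.+1) by lia.
    * by have -> : (j <= t + n) = false by lia.
    * by have -> : (j <= t + n) = false by lia.
  + by rewrite ltnSn.
- by move=> r j /cols; lia.
Qed.

Lemma at_stage_Yplus t Q : at_stage t 0 Q -> at_stage t.+1 0 (Yplus Q).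
Proof.
move=> QS; apply: at_stage_next; rewrite /Yplus; apply: (at_stage_foldl _ QS) => //.
- by apply: sort_sorted => x y; apply: le_total.
- by rewrite sort_uniq fset_uniq.
- move=> c; rewrite mem_sort => /imfsetP[[r c'] /= rP ->].
  have c1 : (1 <= c')%R by apply: (stage_left QS (u := (r, c'))); rewrite inE rP orbT.
  have [j jE] : exists j : nat, c' = j.+1%:Z by exists (absz c').-1; lia.
  move: rP; rewrite jE => /(stage_red_cols QS) ?; exists (n - (j - t).+1); lia.
- move=> r c rP _; rewrite mem_sort; apply/imfsetP; by exists (r, c).
Qed.

End Rect.

(** * The stages starting from a matrix *)

Section RectMatrix.

Import Order.TTheory GRing.Theory Num.Theory.
Local Notation "n %:Z" := (Posz n) : nat_scope.

Definition mx_bit m n (A : 'M[bool]_(m, n)) (k d : nat) : bool :=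
  if (insub (m - k.+1), insub (n - d.+1)) is (Some i, Some j) then A i j else false.

Variables (m n : nat) (A : 'M[bool]_(m, n)).

Notation tile_at k j := ((m%:Z - k%:Z)%R, (j.+1)%:Z).
Notation P := (spd_of_matrix A).
Notation g := (growth (mx_bit A)).

Lemma mem_matrix_tiles (p : 'I_m -> 'I_n -> bool) k j :
  (tile_at k j \in [fset matrix_tile rc | rc in [set rc : 'I_m * 'I_n | p rc.1 rc.2]]%fset) =
  if (insub (m - k.+1), insub j) is (Some r, Some c) then (k < m) && p r c else false.
Proof.
apply/imfsetP/idP => [[[r c] /=]|].
  rewrite inE /= => prc [rE cE]; have := ltn_ord r => rm.
  have -> : m - k.+1 = r by lia.
  have -> : j = c by lia.
  by rewrite !valK prc andbT; lia.
case: insubP => // r _ rE; case: insubP => // c _ cE /andP[km prc].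
exists (r, c); first by rewrite inE.
by rewrite /matrix_tile /= rE cE; congr pair; lia.
Qed.

Lemma mem_black_matrix k j :
  (tile_at k j \in black P) = [&& k < m, j < n & mx_bit A k (n - j.+1)].
Proof.
rewrite (mem_matrix_tiles (fun r c => A r c)) /mx_bit.
case: (ltnP j n) => jn; last first.
  by rewrite /= andbF; case: insubP => [r _ _|] //; rewrite insubF //; lia.
have -> : n - (n - j.+1).+1 = j by lia.
case: insubP => [r _ _|_]; last by rewrite /= andbF.
by case: insubP => [c _ _|_]; rewrite /= ?andbF.
Qed.

Lemma mem_red_matrix k j : k < m ->
  (tile_at k j \in red P) = (j < n) && ~~ mx_bit A k (n - j.+1).
Proof.
move=> km; rewrite (mem_matrix_tiles (fun r c => ~~ A r c)) /mx_bit km.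
case: (ltnP j n) => jn; last first.
  by case: insubP => [r _ _|] //; rewrite insubF //; lia.
have -> : n - (n - j.+1).+1 = j by lia.
case: insubP => [r _ _|]; last by lia.
by case: insubP => [c _ _|] //; rewrite jn.
Qed.

Lemma at_stage_matrix : at_stage m n (mx_bit A) 0 0 P.
Proof.
have tileP u : u \in (black P `|` red P)%fset -> exists rc : 'I_m * 'I_n, u = matrix_tile rc.
  by rewrite inE => /orP[] /imfsetP[rc _ ->]; exists rc.
split.
- by move=> u /tileP[[r c] ->] /=; have := ltn_ord r; lia.
- by move=> u /tileP[[r c] ->] /=; lia.
- move=> k j; rewrite mem_black_matrix /stage_black ltn0 !subn0 !add0n; congr andb.
  case: (ltngtP j n) => //= jn.
  + rewrite /square_black /wave_black /idle /=.
    by have -> : n.-1 - j = n - j.+1 by lia.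
  + by rewrite /blank !growthn0 andbF.
- move=> k j km; rewrite mem_red_matrix // /stage_red ltn0 !subn0 !add0n.
  case: (ltngtP j n) => //= jn.
  rewrite /square_red /wave_red /idle /=.
  by have -> : n.-1 - j = n - j.+1 by lia.
- move=> r j; have := tileP (r, j.+1%:Z).
  rewrite inE => + rP; rewrite rP orbT => /(_ isT) [[u c] [_ ->]].
  by have := ltn_ord c; lia.
Qed.

Lemma at_stage_iter t : at_stage m n (mx_bit A) t 0 (iter t Yplus P).
Proof. by elim: t => [|t IH]; [apply: at_stage_matrix | apply: at_stage_Yplus]. Qed.

Lemma mem_rect_black k j :
  (tile_at k j \in rect_black P) = (k < m) && blank (g k n) (g k.+1 n) j.
Proof.
have [N0 large] := rect_black_large P.
(* Enough iterations for rectification, and more than j, so that all waves have left this column. *)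
have [_ <-] := large (N0 + j.+1) (leq_addr _ _).
rewrite (stage_blackE (at_stage_iter _)) /stage_black.
by have -> : j < N0 + j.+1 by lia.
Qed.

Lemma rect_black_row_pos u : u \in rect_black P -> (0 < u.1)%R.
Proof.
have [N0 large] := rect_black_large P; have [_ E] := large N0 (leqnn _).
have S := at_stage_iter N0; rewrite -E => uP.
have uB : u \in (black (iter N0 Yplus P) `|` red (iter N0 Yplus P))%fset by rewrite inE uP.
have [k kE] : exists k : nat, u.1 = (m%:Z - k%:Z)%R.
  by exists (absz (m%:Z - u.1)%R); have := stage_top S uB; lia.
have [j jE] : exists j : nat, u.2 = (j.+1)%:Z.
  by exists (absz u.2).-1; have := stage_left S uB; lia.
by move: uP; rewrite [u]surjective_pairing kE jE (stage_blackE S) => /andP[km _] /=; lia.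
Qed.

End RectMatrix.

(** * Tableaux of pipe dreams *)

Section Sites.

(* The position of the j-th one of w; it is L if there are at most j ones before L. *)
Definition site (L : nat) (w : nat -> bool) (j : nat) : nat :=
  count (fun x => ones w x.+1 <= j) (iota 0 L).

Lemma ones_mono w : {homo ones w : x y / x <= y}.
Proof.
move=> x y /subnK <-; elim: (y - x) => // l IH.
by rewrite addSn onesS; lia.
Qed.

(** The adjunction between [site] and [ones], valid also when L cuts off the j-th one. It reduces
    later comparisons of sites to arithmetic. *)
Lemma site_lt L w j x : x <= L -> (site L w j < x) = (j < ones w x).
Proof.
rewrite /site; elim: L x => [|L IH] x xL; first by rewrite (_ : x = 0) //; lia.
have -> : iota 0 L.+1 = iota 0 L ++ [:: L] by rewrite -addn1 iotaD.
rewrite count_cat /= addn0.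
case: (leqP (ones w L.+1) j) => jL.
  have -> : count (fun x => ones w x.+1 <= j) (iota 0 L) = L.
    rewrite -[RHS](size_iota 0 L); apply/eqP; rewrite -all_count; apply/allP => y.
    by rewrite mem_iota => yL; apply: leq_trans jL; apply: ones_mono; lia.
  by have := @ones_mono w x L.+1 xL; lia.
rewrite addn0; case: (ltnP L x) => Lx; last by rewrite IH.
have -> : x = L.+1 by lia.
by rewrite jL ltnS -[leqRHS](size_iota 0 L) count_size.
Qed.

Lemma siteP L w j : j < ones w L ->
  [/\ site L w j < L, w (site L w j) & ones w (site L w j) = j].
Proof.
move=> jL; have sL : site L w j < L by rewrite site_lt.
have := site_lt w j (ltnW sL); have := site_lt w j sL.
by rewrite ltnS leqnn ltnn onesS; case: (w _); split; lia.
Qed.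

Lemma siteE L (w : nat -> bool) j x : x < L -> w x -> ones w x = j -> site L w j = x.
Proof.
move=> xL wx <-; have := site_lt w (ones w x) xL; have := site_lt w (ones w x) (ltnW xL).
by rewrite onesS wx; lia.
Qed.

Lemma site_ge L w j : j < ones w L -> j <= site L w j.
Proof.
case/siteP=> _ _ {1}<-.
by rewrite -[leqRHS](size_iota 0) count_size.
Qed.

Lemma blank_first L w z x : interlaced w z -> x < site L z 0 -> x < L -> blank w z x.
Proof.
move=> iz xs xL.
have := site_lt z 0 xL; have := ones_lag x.+1 iz; rewrite !onesS /blank.
have := ones_lag x iz; by lia.
Qed.

(** The way of a pipe through one row: it comes up at the j-th one of [w], bumps to the right,
    crosses the blanks, and bumps upwards at the next one of [z]. *)
Lemma blank_between L w z j : interlaced w z -> j < ones w L -> j.+1 < ones z L ->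
  [/\ site L w j < site L z j.+1,
      forall x, site L w j < x < site L z j.+1 -> blank w z x,
      ~~ blank w z (site L w j) & ~~ blank w z (site L z j.+1)].
Proof.
move=> iz jw jz; have [qL wq qj] := siteP jw; have [qL' zq qj'] := siteP jz.
split; rewrite ?/blank ?wq ?zq ?andbF //.
  rewrite leqNgt -ltnS ltnS site_lt //.
  by rewrite (ones_lag _ iz) lagS wq onesS wq qj; lia.
move=> x /andP[qx xq].
have xL : x < L by lia.
have := site_lt z j.+1 xL; have := site_lt w j (ltnW xL).
have := ones_lag x.+1 iz; rewrite !onesS /blank.
have := ones_lag x iz; lia.
Qed.

End Sites.

(** * Following a pipe *)

Section Trace.

Import Order.TTheory GRing.Theory Num.Theory.
Local Notation "n %:Z" := (Posz n) : nat_scope.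

Variable V : {fset tile}.

Definition trace (s : tile * bool) (K : nat) : seq nat :=
  [seq absz (iter k (pipe_step V) s).1.1
     | k <- iota 0 K & ((iter k (pipe_step V) s).1 \in V) && (iter k (pipe_step V) s).2].

Lemma traceD s a b : trace s (a + b) = trace s a ++ trace (iter a (pipe_step V) s) b.
Proof.
rewrite /trace iotaD filter_cat map_cat add0n; congr cat.
rewrite -[a in iota a b]addn0 iotaDl filter_map -map_comp.
under eq_filter => k do rewrite /= addnC iterD.
by apply: eq_map => k /=; rewrite addnC iterD.
Qed.

Lemma trace1 s : trace s 1 = if (s.1 \in V) && s.2 then [:: absz s.1.1] else [::].
Proof. by rewrite /trace /=; case: ifP. Qed.

Lemma trace_run (r c : int) (l : nat) :
  (forall x, x < l -> (r, c + x%:Z)%R \in V) -> (r, c + l%:Z)%R \notin V ->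
  iter l.+1 (pipe_step V) ((r, c), true) = ((r - 1, c + l%:Z)%R, false) /\
  trace ((r, c), true) l.+1 = nseq l (absz r).
Proof.
elim: l c => [|l IH] c inV notV.
  by move: notV; rewrite addr0 trace1 /= => /negbTE->.
have c1 x : (c + 1 + x%:Z = c + x.+1%:Z)%R by lia.
have [|| E T] := IH (c + 1)%R.
- by move=> x xl; rewrite c1; apply: inV.
- by rewrite c1.
have cV : (r, c) \in V by have := inV 0 isT; rewrite addr0.
have step1 : pipe_step V ((r, c), true) = ((r, c + 1)%R, true) by rewrite /= cV.
split; first by rewrite iterSr step1 E c1.
by rewrite -add1n traceD trace1 /= cV T.
Qed.

Lemma trace_above s K : (forall u, u \in V -> (0 < u.1)%R) -> (s.1.1 <= 0)%R ->
  trace s K = [::].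
Proof.
move=> posV; elim: K s => // K IH s s0.
rewrite -add1n traceD trace1 /= IH.
  by case: ifP => // /andP[/posV]; rewrite ltNge s0.
by case: s s0 => -[r c] b /=; case: ifP => _; case: b => /=; lia.
Qed.

End Trace.

Section Tab.

Import Order.TTheory GRing.Theory Num.Theory.
Local Notation "n %:Z" := (Posz n) : nat_scope.

Variables (m n : nat) (B : nat -> nat -> bool) (V : {fset tile}).

Notation g k := (growth B k n).
Notation tile_at k j := ((m%:Z - k%:Z)%R, (j.+1)%:Z).

Hypothesis posV : forall u, u \in V -> (0 < u.1)%R.
Hypothesis memV : forall k j,
  (tile_at k j \in V) = (k < m) && blank (g k) (g k.+1) j.

(* The number of crosses passed horizontally in the k lowest rows by the pipe that enters
   at the left edge in the p-th row from the bottom. *)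
Definition row_length (p k : nat) : nat :=
  if p < k then site (m + n) (g k) (k - p.+1) - (k - p.+1) else 0.

Lemma ones_g k : k <= m -> ones (g k) (m + n) = k.
Proof. by move=> km; rewrite ones_growth //; lia. Qed.

(** In its first row the pipe turns up at the one of index 0, and each further row raises the index
    by one ([blank_between]). The crosses in a row are the zeros gained before that one, which is
    the increment of [row_length]. *)
Lemma pipe_row_trace p l : p + l < m ->
  exists T, iter T (pipe_step V) ((m%:Z - p%:Z, 1)%R, true) =
      (tile_at (p + l).+1 (site (m + n) (g (p + l).+1) l), false) /\
    trace V ((m%:Z - p%:Z, 1)%R, true) T =
    flatten [seq nseq (row_length p k.+1 - row_length p k) (m - k) | k <- iota p l.+1].
Proof.
elim: l => [|l IH] pl.
  have [iz _] := interlaced_growth B p n.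
  have [qL zq _] : [/\ site (m + n) (g p.+1) 0 < m + n, g p.+1 (site (m + n) (g p.+1) 0)
      & ones (g p.+1) (site (m + n) (g p.+1) 0) = 0] by apply: siteP; rewrite ones_g; lia.
  have [||E T] := @trace_run V (m%:Z - p%:Z)%R 1%R (site (m + n) (g p.+1) 0).
  - move=> x xs; rewrite (_ : 1 + x%:Z = x.+1%:Z)%R; last lia.
    by rewrite memV (blank_first iz xs) ?andbT; lia.
  - rewrite (_ : 1 + (site (m + n) (g p.+1) 0)%:Z = (site (m + n) (g p.+1) 0).+1%:Z)%R; last lia.
    by rewrite memV /blank zq !andbF.
  exists (site (m + n) (g p.+1) 0).+1; rewrite E T addn0; split.
    by congr (_, _, _); lia.
  rewrite /= cats0 /row_length ltnSn ltnn subnn !subn0; congr nseq; lia.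
have [|T [E F]] := IH; first lia.
set k := (p + l).+1 in E F.
have -> : p + l.+1 = k by rewrite addnS.
have [iz _] := interlaced_growth B k n.
have [||q_lt between nq nq'] := @blank_between (m + n) _ _ l iz; rewrite ?ones_g; try lia.
set q := site (m + n) (g k) l in E q_lt between nq.
set q' := site (m + n) (g k.+1) l.+1 in q_lt between nq' *.
have qV : tile_at k q \notin V by rewrite memV negb_and nq orbT.
have [||E' T'] := @trace_run V (m%:Z - k%:Z)%R (q.+2)%:Z (q' - q.+1).
- move=> x xs; rewrite (_ : q.+2%:Z + x%:Z = (q.+1 + x).+1%:Z)%R; last lia.
  by rewrite memV between ?andbT; lia.
- rewrite (_ : q.+2%:Z + (q' - q.+1)%:Z = q'.+1%:Z)%R; last lia.
  by rewrite memV negb_and nq' orbT.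
have step1 : pipe_step V (tile_at k q, false) = ((m%:Z - k%:Z, q.+2%:Z)%R, true).
  by rewrite /= (negbTE qV); congr (_, _, _); lia.
have iter1 s : iter 1 (pipe_step V) s = pipe_step V s by [].
(* The T steps so far, one for the bump to the right, then the crosses of the new row and the bump
   upwards. *)
exists ((q' - q.+1).+1 + (1 + T)); split.
  by rewrite iterD iterD E iter1 step1 E'; congr (_, _, _); lia.
rewrite -[l.+2]addn1 iotaD map_cat flatten_cat.
rewrite (addnC _ (1 + T)) traceD (addnC 1 T) traceD F E (addnC T 1) iterD E iter1 step1.
rewrite T' trace1 /= (negbTE qV) /=.
rewrite -catA; congr cat.
rewrite /= cats0 addnS -/k /row_length.
have -> : p < k.+1 by lia.
have -> : p < k by lia.
have -> : k.+1 - p.+1 = l.+1 by lia.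
have -> : k - p.+1 = l by lia.
rewrite -/q -/q'; congr nseq; last lia.
have : l <= q by apply: site_ge; rewrite ones_g; lia.
lia.
Qed.

Lemma pipe_rowE p : p < m ->
  pipe_row V (m - p) =
  flatten [seq nseq (row_length p k.+1 - row_length p k) (m - k) | k <- iota p (m - p)].
Proof.
move=> pm; have [|T [E F]] := @pipe_row_trace p (m - p.+1); first lia.
(* T extra steps allow the trace to be cut after exactly T steps, when the pipe is above row 1. *)
rewrite -(pipe_row_large posV (leq_addl T _)).
rewrite /pipe_row_upto -/(trace V ((m - p)%:Z, 1%R, true) _) traceD.
have mp : (m - p)%:Z = (m%:Z - p%:Z)%R by lia.
rewrite mp E F trace_above //; last by rewrite /=; lia.
by rewrite cats0; have -> : (m - p.+1).+1 = m - p by lia.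
Qed.

Lemma tabE : tab m V =
  [seq row <- [seq flatten [seq nseq (row_length p k.+1 - row_length p k) (m - k)
      | k <- iota p (m - p)] | p <- iota 0 m] | row != [::]].
Proof.
rewrite /tab; congr filter.
have -> : rev (iota 1 m) = [seq m - p | p <- iota 0 m].
  apply: (@eq_from_nth _ 0); rewrite size_rev size_iota; first by rewrite size_map size_iota.
  move=> i im; rewrite nth_rev size_iota // nth_iota ?(nth_map 0) ?size_iota ?nth_iota //; lia.
rewrite -map_comp; apply/eq_in_map => p; rewrite mem_iota => pm /=.
by rewrite pipe_rowE.
Qed.

Lemma row_length_mono p k : k < m -> row_length p k <= row_length p k.+1.
Proof.
move=> km; rewrite /row_length; case: (ltnP p k) => // pk.
have -> : p < k.+1 by lia.
have [iz _] := interlaced_growth B k n.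
have -> : k.+1 - p.+1 = (k - p.+1).+1 by lia.
have [||q_lt _ _ _] := @blank_between (m + n) _ _ (k - p.+1) iz; rewrite ?ones_g; lia.
Qed.

End Tab.

(** * Recording tableaux and complements *)

Section Staircase.

(** Two readings of a staircase, by value and by position. Pipes yield tableau rows grouped by
    value, while the comparison of tableaux is made box by box. *)
Lemma flatten_nseq_increments (T : Type) (len : nat -> nat) (v e : nat -> T) a b :
  (forall k, a <= k < a + b -> len k <= len k.+1) ->
  (forall k j, a <= k < a + b -> len k <= j < len k.+1 -> e j = v k) ->
  flatten [seq nseq (len k.+1 - len k) (v k) | k <- iota a b] =
  [seq e j | j <- iota (len a) (len (a + b) - len a)].
Proof.
elim: b => [|b IH] mono H; first by rewrite addn0 subnn.
have lenab : len a <= len (a + b).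
  elim: b mono {IH H} => [|b IH] mono; first by rewrite addn0.
  rewrite addnS; apply: leq_trans (mono (a + b) _); last lia.
  by apply: IH => k kb; apply: mono; lia.
have M := mono (a + b) ltac:(lia).
rewrite -[b.+1]addn1 iotaD map_cat flatten_cat IH; first last.
- by move=> k j kb; apply: H; lia.
- by move=> k kb; apply: mono; lia.
rewrite /= cats0 addn1 addnS.
have -> : len (a + b).+1 - len a = (len (a + b) - len a) + (len (a + b).+1 - len (a + b)) by lia.
rewrite iotaD map_cat; congr cat; rewrite subnKC //.
apply: (@eq_from_nth _ (v a)); first by rewrite size_nseq size_map size_iota.
move=> i; rewrite size_nseq => il.
rewrite nth_nseq il (nth_map 0) ?size_iota // nth_iota //.
by rewrite (H (a + b)) //; lia.
Qed.

Lemma size_flatten_nseq_increments (T : Type) (len : nat -> nat) (v : nat -> T) a b :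
  (forall k, a <= k < a + b -> len k <= len k.+1) ->
  size (flatten [seq nseq (len k.+1 - len k) (v k) | k <- iota a b]) = len (a + b) - len a.
Proof.
move=> mono.
have E := @flatten_nseq_increments _ len (fun=> tt) (fun=> tt) a b mono (fun _ _ _ _ => erefl).
have -> : size (flatten [seq nseq (len k.+1 - len k) (v k) | k <- iota a b]) =
   size (flatten [seq nseq (len k.+1 - len k) tt | k <- iota a b]).
  rewrite !size_flatten /shape -!map_comp; congr sumn; apply: eq_map => k /=.
  by rewrite !size_nseq.
by rewrite E size_map size_iota.
Qed.

(** For monotone f this is the step at which f rises past p, see [levelE]. *)
Definition level (f : nat -> nat) (n p : nat) : nat :=
  count (fun k => f k.+1 <= p) (iota 0 n).

Lemma steps_mono (f : nat -> nat) n : (forall k, k < n -> f k <= f k.+1) ->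
  forall i j, i <= j <= n -> f i <= f j.
Proof.
move=> mono i j /andP[ij]; rewrite -(subnKC ij); elim: (j - i) => [|l IH] ln.
  by rewrite addn0.
by rewrite addnS; apply: leq_trans (IH _) (mono _ _); lia.
Qed.

Lemma levelE f n k p : (forall k, k < n -> f k <= f k.+1) -> k < n ->
  f k <= p < f k.+1 -> level f n p = k.
Proof.
move=> mono kn /andP[fkp pfk]; have M := steps_mono mono.
rewrite /level -(subnKC (ltnW kn)) iotaD count_cat add0n.
have -> : count (fun i => f i.+1 <= p) (iota 0 k) = k.
  rewrite -[RHS](size_iota 0 k); apply/eqP; rewrite -all_count; apply/allP => y.
  by rewrite mem_iota => yk; apply: leq_trans fkp; apply: M; lia.
have -> : count (fun i => f i.+1 <= p) (iota k (n - k)) = 0; last by rewrite addn0.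
apply/eqP; rewrite -leqn0 leqNgt -has_count -all_predC; apply/allP => y.
rewrite mem_iota /= => yk; rewrite -ltnNge; apply: leq_trans pfk _; apply: M; lia.
Qed.

Lemma jumps_levels (f : nat -> nat) n : f 0 = 0 ->
  (forall k, k < n -> f k <= f k.+1 <= (f k).+1) ->
  [seq n - k | k <- iota 0 n & f k.+1 != f k] = [seq n - level f n p | p <- iota 0 (f n)].
Proof.
move=> f0 step.
have mono k : k < n -> f k <= f k.+1 by move/step/andP=> [].
have -> : [seq n - k | k <- iota 0 n & f k.+1 != f k] =
    flatten [seq nseq (f k.+1 - f k) (n - k) | k <- iota 0 n].
  have: {subset iota 0 n <= gtn n} by move=> k; rewrite mem_iota.
  elim: (iota 0 n) => //= k s IH sub.
  have kn : k < n by apply: (sub k); rewrite mem_head.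
  rewrite -IH; last by move=> x xs; apply: sub; rewrite inE xs orbT.
  have := step k kn; case: eqP => [->|ne] /=; first by rewrite subnn.
  by move=> h; have -> : f k.+1 - f k = 1 by lia.
rewrite (@flatten_nseq_increments _ _ _ (fun p => n - level f n p)) ?f0 ?subn0 //.
by move=> k j kn fk; rewrite (@levelE f n k).
Qed.

Lemma filter_iota_lt a b : a <= b -> [seq x <- iota 0 b | x < a] = iota 0 a.
Proof.
move=> ab; rewrite -(subnKC ab) iotaD filter_cat add0n.
rewrite (eq_in_filter (a2 := predT)); last by move=> x; rewrite mem_iota => /andP[_ ->].
rewrite filter_predT (eq_in_filter (a2 := pred0)) ?filter_pred0 ?cats0 //.
by move=> x; rewrite mem_iota => /andP[xa _]; rewrite ltnNge xa.
Qed.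

Lemma count_prefix (a : pred nat) m q : (forall i, i.+1 < m -> a i.+1 -> a i) ->
  q < m -> (q < count a (iota 0 m)) = a q.
Proof.
move=> down qm; have downs i j : i <= j < m -> a j -> a i.
  move=> /andP[ij]; rewrite -(subnKC ij); elim: (j - i) => [|l IH]; first by rewrite addn0.
  by rewrite addnS => lm /(down _ lm); apply: IH; lia.
have -> : m = q.+1 + (m - q.+1) by lia.
rewrite iotaD count_cat; case: (boolP (a q)) => aq.
  rewrite (_ : count a (iota 0 q.+1) = q.+1) ?leq_addr //.
  rewrite -[RHS](size_iota 0 q.+1); apply/eqP; rewrite -all_count; apply/allP => y.
  by rewrite mem_iota => yq; apply: downs aq; lia.
rewrite (_ : count a (iota (0 + q.+1) _) = 0).
  rewrite -addn1 iotaD count_cat /= (negbTE aq) !addn0.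
  by have := count_size a (iota 0 q); rewrite size_iota; lia.
apply/eqP; rewrite -leqn0 leqNgt -has_count -all_predC; apply/allP => y.
by rewrite mem_iota /= => yq; apply: contra aq; apply: downs; lia.
Qed.

End Staircase.

(** * Shapes read off the words *)

Section Shapes.

Variables (m n : nat) (B : nat -> nat -> bool).

(* With k the number of last columns of A used, the row lengths of ins are holes_before k j
   for j = m - 1, ..., 0. *)
Definition holes_before (k j : nat) : nat := site (m + n) (growth B m k) j - j.

Lemma site_widen L L' w j : j < ones w L -> L <= L' -> site L' w j = site L w j.
Proof. by case/siteP=> sL ws os LL; apply: siteE => //; lia. Qed.

Lemma site_holes k j : k <= n -> j < m ->
  site (m + n) (growth B m k) j = holes_before k j + j.
Proof.
move=> kn jm; rewrite /holes_before subnK //; apply: site_ge.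
by rewrite ones_growth //; lia.
Qed.

(** The complemented words are interlaced, so one more column of the matrix moves the j-th one by at
    most one place: a vertical strip is added. *)
Lemma holes_before_step k j : k < n -> j < m ->
  holes_before k j <= holes_before k.+1 j <= (holes_before k j).+1.
Proof.
move=> kn jm; have := site_holes (ltnW kn) jm; have := site_holes kn jm.
set w := growth B m k; set w' := growth B m k.+1.
have [_ iw] := interlaced_growth B m k; rewrite -/w -/w' in iw.
have jw : j < ones w (m + n) by rewrite ones_growth; lia.
have jw' : j < ones w' (m + n) by rewrite ones_growth; lia.
have [qL wq qj] := siteP jw; have [qL' wq' qj'] := siteP jw'.
have onesE x : ones w x = ones w' x + lag (compl w) (compl w') x.
  have := ones_lag x iw; rewrite !ones_compl.
  have : ones w x <= x by rewrite -[leqRHS](size_iota 0 x) count_size.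
  have : ones w' x <= x by rewrite -[leqRHS](size_iota 0 x) count_size.
  lia.
set q := site _ w j in qL wq qj *; set q' := site _ w' j in qL' wq' qj' *.
have q_le : q <= q'.
  by rewrite -ltnS site_lt // onesE onesS wq' qj'; lia.
(* If the lag is positive at [q.+1], interlacing puts a one of [w'] there; otherwise [w'] has
   already had [j.+1] ones. *)
have q'_le : q' <= q.+1.
  case: (leqP q' q) => [/leqW//|qq'].
  have q2 : q.+1 < m + n by lia.
  have := onesE q.+1; rewrite onesS wq qj.
  have := site_lt w' j (ltnW q2); have := iw q.+1; rewrite -/q'.
  rewrite complE negbK; case: (lag _ _ _) => /= [w1|]; last by lia.
  by move=> _ E; rewrite -ltnS site_lt // onesS w1; lia.
lia.
Qed.

Lemma holes_before0 j : j < m -> holes_before 0 j = 0.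
Proof.
move=> jm; rewrite /holes_before (@siteE _ _ j j) ?subnn ?growthn0 //; first lia.
elim: j jm => // j IH jm; rewrite onesS IH ?growthn0; lia.
Qed.

Lemma holes_before_le k j : k <= n -> j < m -> holes_before k j <= k.
Proof.
move=> + jm; elim: k => [|k IH] kn; first by rewrite holes_before0.
by have := holes_before_step kn jm; have := IH (ltnW kn); lia.
Qed.

Lemma holes_before_mono k j : k <= n -> j.+1 < m ->
  holes_before k j <= holes_before k j.+1.
Proof.
move=> kn jm; have := site_holes kn jm; have := site_holes kn (ltnW jm).
have jw : j.+1 < ones (growth B m k) (m + n) by rewrite ones_growth; lia.
have [qL wq qj] := siteP jw.
have := site_lt (growth B m k) j (ltnW qL); rewrite qj ltnSn; lia.
Qed.

(** Ones further right have more zeros before them, so reversing the index gives weakly decreasing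
    parts. *)
Definition row_holes (k q : nat) : nat := holes_before k (m.-1 - q).

Lemma row_holes_anti k q q' : k <= n -> q <= q' < m -> row_holes k q' <= row_holes k q.
Proof.
move=> kn /andP[qq' qm].
apply: (@steps_mono (holes_before k) m.-1); last lia.
by move=> j jm; apply: holes_before_mono => //; lia.
Qed.

Lemma row_holes_step k q : k < n -> q < m ->
  row_holes k q <= row_holes k.+1 q <= (row_holes k q).+1.
Proof. by move=> kn qm; apply: holes_before_step => //; lia. Qed.

Lemma row_holes0 q : q < m -> row_holes 0 q = 0.
Proof. by move=> qm; apply: holes_before0; lia. Qed.

Lemma row_length_holes d p : d <= n -> p < m -> row_length m d B p m = row_holes d p.
Proof.
move=> dn pm; rewrite /row_length pm /row_holes /holes_before.
have -> : m - p.+1 = m.-1 - p by lia.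
by rewrite (@site_widen (m + d) (m + n)) ?ones_growth; lia.
Qed.

(** The dual word is the complement of [h], so the dual row length counts the ones of [h] before its
    zero of index [k - p.+1]. The j-th one is among them exactly when at most [k - p.+1] zeros
    precede it. *)
Lemma row_length_dual p k j : k <= n -> j < m -> p < k ->
  (j < row_length n m (fun x y => ~~ B y x) p k) = (p < k - holes_before k j).
Proof.
move=> kn jm pk; rewrite /row_length pk.
set u := growth _ k m; set h := growth B m k.
have uh x : x < m + k -> u x = ~~ h x by exact: growth_dual.
have onesu x : x <= m + k -> ones u x = x - ones h x.
  move=> xk; rewrite -ones_compl /ones; apply: eq_in_count => y.
  by rewrite mem_iota => yx; rewrite uh //; lia.
have hx x : ones h x <= x by rewrite -[leqRHS](size_iota 0 x) count_size.
have jh : j < ones h (m + k) by rewrite ones_growth.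
have ku : k - p.+1 < ones u (m + k) by rewrite ones_growth; lia.
have := site_holes kn jm; rewrite -/h.
rewrite (@site_widen (m + k)) //; last lia.
rewrite (@site_widen (m + k) (n + m)) //; last lia.
have [qL hq qj] := siteP jh; have [rL ur rk] := siteP ku.
have := site_lt h j (ltnW rL); have := site_lt u (k - p.+1) (ltnW qL).
have := onesu _ (ltnW rL); have := onesu _ (ltnW qL).
have := hx (site (m + k) h j); have := hx (site (m + k) u (k - p.+1)).
have ne : site (m + k) h j <> site (m + k) u (k - p.+1).
  by move=> e; move: ur; rewrite uh // -e hq.
rewrite qj rk; lia.
Qed.

Lemma row_length_dual_le p k : k <= n ->
  row_length n m (fun x y => ~~ B y x) p k <= m.
Proof.
move=> kn; rewrite /row_length; case: ifP => // pk.
set u := growth _ k m.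
have ku : k - p.+1 < ones u (m + k) by rewrite ones_growth; lia.
rewrite (@site_widen (m + k) (n + m)) //; last lia.
have [rL ur rk] := siteP ku.
have := ones_compl u (site (m + k) u (k - p.+1)); rewrite rk => <-.
have := @ones_mono (compl u) _ _ (ltnW rL).
have := ones_compl u (m + k); rewrite (@ones_growth _ k m); lia.
Qed.

End Shapes.

(** * The recording tableau and its complement *)

Section Recording.

Lemma mx_bit_suffix m n (A : 'M[bool]_(m, n)) i k d : i <= n -> d < n - i ->
  mx_bit (suffix_mx A i) k d = mx_bit A k d.
Proof.
move=> iln dn; rewrite /mx_bit; case: insubP => // r _ _.
case: insubP => [c _ cE|]; last by lia.
case: insubP => [c' _ cE'|]; last by lia.
by rewrite mxE; congr (A _ _); apply: val_inj; rewrite /= cE cE'; lia.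
Qed.

Lemma mx_bit_transpose_complement m n (A : 'M[bool]_(m, n)) k d : d < m -> k < n ->
  mx_bit (transpose_complement A) k d = ~~ mx_bit A d k.
Proof.
move=> dm kn; rewrite /mx_bit; case: insubP => [c _ cE|]; last by lia.
case: insubP => [r _ rE|]; last by lia.
by rewrite mxE.
Qed.

Lemma ins_rows m n (A : 'M[bool]_(m, n)) :
  ins A = [seq row <- [seq flatten
      [seq nseq (row_length m n (mx_bit A) p k.+1 - row_length m n (mx_bit A) p k) (m - k)
        | k <- iota p (m - p)] | p <- iota 0 m] | row != [::]].
Proof. by apply: tabE; [apply: rect_black_row_pos | apply: mem_rect_black]. Qed.

Variables (m n : nat) (A : 'M[bool]_(m, n)).
Hypothesis m_gt0 : 0 < m.

Notation rh := (row_holes m n (mx_bit A)).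
Notation hb := (holes_before m n (mx_bit A)).

Lemma shape_ins_suffix i : i <= n ->
  tableau_shape (ins (suffix_mx A i)) =
  [seq l <- [seq rh (n - i) q | q <- iota 0 m] | l != 0].
Proof.
move=> iln; rewrite ins_rows /tableau_shape.
set R := fun p : nat => flatten _.
have -> : [seq rh (n - i) q | q <- iota 0 m] = [seq size row | row <- map R (iota 0 m)].
  rewrite -map_comp; apply/eq_in_map => p; rewrite mem_iota => /andP[_ pm] /=.
  rewrite size_flatten_nseq_increments => [|k kb]; last by apply: row_length_mono; lia.
  rewrite subnKC; last lia.
  rewrite -(row_length_holes (mx_bit A) (leq_subr i n) pm) /row_length pm ltnn subn0.
  by congr (site _ _ _ - _); apply: growth_ext => x y xm yn; rewrite mx_bit_suffix.
by rewrite [RHS]filter_map; congr map; apply: eq_filter => row; rewrite -size_eq0.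
Qed.

Definition column_count (d P : nat) : nat := count (fun q => P < rh d q) (iota 0 m).

Lemma lt_column_count d P q : d <= n -> q < m -> (q < column_count d P) = (P < rh d q).
Proof.
move=> dn qm; rewrite /column_count count_prefix // => i im.
by move/leq_trans; apply; apply: row_holes_anti => //; lia.
Qed.

Lemma column_count_le d P : column_count d P <= m.
Proof. by rewrite -[leqRHS](size_iota 0 m) count_size. Qed.

Lemma conj_shape_ins_suffix i : i <= n ->
  conj_partition (tableau_shape (ins (suffix_mx A i))) =
  [seq column_count (n - i) P | P <- iota 0 (rh (n - i) 0)].
Proof.
move=> iln; rewrite shape_ins_suffix // /conj_partition.
have anti q : q < m -> rh (n - i) q <= rh (n - i) 0.
  by move=> qm; apply: row_holes_anti => //; lia.
have -> : head 0 [seq l <- [seq rh (n - i) q | q <- iota 0 m] | l != 0] = rh (n - i) 0.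
  have -> : iota 0 m = 0 :: iota 1 m.-1 by rewrite -[in LHS](prednK m_gt0).
  rewrite /=; case: eqP => //= r0.
  rewrite (eq_in_filter (a2 := pred0)) ?filter_pred0 // => l /mapP[q].
  rewrite mem_iota => qm ->; have := anti q ltac:(lia).
  by rewrite r0 leqn0 => /eqP->.
apply: eq_map => P; rewrite /column_count count_filter count_map.
by apply: eq_count => q /=; case: (ltnP P _) => //; lia.
Qed.

(** The box enters when the q-th part first exceeds P. If this happens on passing from k to [k.+1]
    last columns, the new column has 1-based index [n - k]. *)
Definition rec_entry (P q : nat) : nat := n - level (rh ^~ q) n P.

Lemma rec_entryE k P q : k < n -> q < m -> rh k q <= P < rh k.+1 q ->
  rec_entry P q = n - k.
Proof.
move=> kn qm kP; rewrite /rec_entry (levelE _ kn kP) // => l ln.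
by have /andP[] := row_holes_step (mx_bit A) ln qm.
Qed.

Definition rec_table (d : nat) : tableau :=
  [seq [seq rec_entry P q | q <- iota 0 (column_count d P)] | P <- iota 0 (rh d 0)].

Lemma nth_rec_table d P : d <= n ->
  nth [::] (rec_table d) P = [seq rec_entry P q | q <- iota 0 (column_count d P)].
Proof.
move=> dn; rewrite /rec_table; case: (ltnP P (rh d 0)) => PS.
  by rewrite (nth_map 0) ?size_iota // nth_iota.
rewrite nth_default ?size_map ?size_iota //.
suff -> : column_count d P = 0 by [].
by apply/eqP; rewrite -leqn0 leqNgt lt_column_count // -leqNgt.
Qed.

Lemma extend_rec_table d : d < n ->
  extend_tableau (n - d) [seq column_count d.+1 P | P <- iota 0 (rh d.+1 0)] (rec_table d) =
  rec_table d.+1.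
Proof.
move=> dn; rewrite /extend_tableau size_map size_iota; apply/eq_in_map => P.
rewrite mem_iota => /andP[_ PS]; rewrite (nth_map 0) ?size_iota // nth_iota //.
apply/eq_in_map => q; rewrite mem_iota => /andP[_ qS].
have qm : q < m by apply: leq_trans qS (column_count_le _ _).
have dn' := ltnW dn; rewrite /in_tableau /entry nth_rec_table //.
rewrite size_map size_iota lt_column_count //.
rewrite lt_column_count // in qS.
case: ltnP => Pq; last by rewrite (@rec_entryE d) // Pq.
by rewrite (nth_map 0) ?size_iota ?nth_iota // lt_column_count.
Qed.

Lemma recE : rec A = rec_table n.
Proof.
rewrite /rec.
suff H d : d <= n -> foldr (fun i T => extend_tableau i.+1
   (conj_partition (tableau_shape (ins (suffix_mx A i)))) T) [::] (iota (n - d) d) = rec_table d.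
  by have := H n (leqnn n); rewrite subnn.
elim: d => [_|d IH dn].
  by rewrite /rec_table row_holes0.
rewrite /= (_ : (n - d.+1).+1 = n - d); last lia.
rewrite IH ?(ltnW dn) // conj_shape_ins_suffix; last lia.
by rewrite (_ : n - (n - d.+1) = d.+1) ?extend_rec_table //; lia.
Qed.

(** Lists the column by the times at which its length grows, a form in which complements are easy to
    take. *)
Lemma column_recE q : q < m ->
  column (rec A) q = [seq n - k | k <- iota 0 n & rh k.+1 q != rh k q].
Proof.
move=> qm; rewrite recE (@jumps_levels (rh ^~ q)); first last.
- by move=> k kn; apply: row_holes_step.
- exact: row_holes0.
rewrite /column /rec_table filter_map -map_comp.
have -> : [seq P <- iota 0 (rh n 0) |
    preim (fun P => [seq rec_entry P q | q <- iota 0 (column_count n P)])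
      (fun row => q < size row) P] = iota 0 (rh n q).
  rewrite -(@filter_iota_lt (rh n q) (rh n 0)); last by apply: row_holes_anti => //; lia.
  by apply: eq_filter => P /=; rewrite size_map size_iota lt_column_count.
apply/eq_in_map => P; rewrite mem_iota => /andP[_ Pq] /=.
by rewrite (nth_map 0) ?size_iota ?nth_iota // lt_column_count.
Qed.

(** The zeros after the j-th one, out of k in all. *)
Definition holes_after (j k : nat) : nat := k - hb k j.

Lemma holes_after_step j k : k < n -> j < m ->
  holes_after j k <= holes_after j k.+1 <= (holes_after j k).+1.
Proof.
move=> kn jm; have := holes_before_step (mx_bit A) kn jm.
have := holes_before_le (mx_bit A) (ltnW kn) jm; rewrite /holes_after; lia.
Qed.

(** [holes_before] rises by 0 or 1 at each step, so [holes_after] rises exactly at the other steps.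
    The reversal of columns in the complement cancels the reversal in [row_holes]. *)
Lemma complement_column j : j < m ->
  [seq x <- rev (iota 1 n) | x \notin column (rec A) (m - j.+1)] =
  [seq n - level (holes_after j) n p | p <- iota 0 (holes_after j n)].
Proof.
move=> jm; rewrite column_recE; last lia.
rewrite -(@jumps_levels (holes_after j)); first last.
- by move=> k kn; apply: holes_after_step.
- by rewrite /holes_after.
have -> : rev (iota 1 n) = [seq n - k | k <- iota 0 n].
  apply: (@eq_from_nth _ 0); rewrite size_rev size_iota; first by rewrite size_map size_iota.
  move=> i im; rewrite nth_rev size_iota // nth_iota ?(nth_map 0) ?size_iota ?nth_iota //; lia.
rewrite filter_map; congr map; apply: eq_in_filter => k; rewrite mem_iota => /andP[_ kn] /=.
have -> : (n - k \in [seq n - k0 | k0 <- iota 0 n & rh k0.+1 (m - j.+1) != rh k0 (m - j.+1)]) =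
   (rh k.+1 (m - j.+1) != rh k (m - j.+1)).
  apply/mapP/idP => [[k1]|H]; last by exists k; rewrite // mem_filter H mem_iota.
  by rewrite mem_filter mem_iota => /andP[H /andP[_ k1n]] e; have -> : k = k1 by lia.
rewrite /row_holes (_ : m.-1 - (m - j.+1) = j); last lia.
have kn' : k < n := kn; have := holes_before_step (mx_bit A) kn' jm.
have := holes_before_le (mx_bit A) (ltnW kn') jm.
by rewrite /holes_after; case: eqP => /= ?; case: eqP => /=; lia.
Qed.

Lemma holes_after_anti j : j < m -> holes_after j n <= holes_after 0 n.
Proof.
move=> jm; have := @row_holes_anti m n (mx_bit A) n (m.-1 - j) m.-1 (leqnn n).
rewrite /row_holes subnn (_ : m.-1 - (m.-1 - j) = j) /holes_after; lia.
Qed.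

(** By [row_length_dual], row p reaches column j at the step at which [holes_after j] rises past p,
    so this step gives the entry of the box. *)
Lemma insE_dual : ins (transpose_complement A) =
  [seq [seq n - level (holes_after j) n p | j <- iota 0 m & p < holes_after j n]
     | p <- iota 0 (holes_after 0 n)].
Proof.
rewrite ins_rows.
set len := row_length n m (fun x y => ~~ mx_bit A y x).
have lenE p k : k <= n -> row_length n m (mx_bit (transpose_complement A)) p k = len p k.
  move=> kn; rewrite /len /row_length; congr (if _ then _ - _ else _).
  congr site; apply: growth_ext => x y xk ym.
  by rewrite mx_bit_transpose_complement //; lia.
have len_dual p k j : k <= n -> j < m -> p < k -> (j < len p k) = (p < holes_after j k).
  exact: row_length_dual.
have lenpp p : len p p = 0 by rewrite /len /row_length ltnn.
have rowE p : p < n ->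
  flatten [seq nseq (row_length n m (mx_bit (transpose_complement A)) p k.+1 -
     row_length n m (mx_bit (transpose_complement A)) p k) (n - k) | k <- iota p (n - p)] =
  [seq n - level (holes_after j) n p | j <- iota 0 m & p < holes_after j n].
  move=> pn.
  have -> : [seq nseq (row_length n m (mx_bit (transpose_complement A)) p k.+1 -
     row_length n m (mx_bit (transpose_complement A)) p k) (n - k) | k <- iota p (n - p)] =
     [seq nseq (len p k.+1 - len p k) (n - k) | k <- iota p (n - p)].
    by apply/eq_in_map => k; rewrite mem_iota => kb; rewrite !lenE //; lia.
  rewrite (@flatten_nseq_increments _ _ _ (fun j => n - level (holes_after j) n p)).
  - rewrite lenpp subn0 subnKC ?(ltnW pn) //; congr map.
    rewrite -(@filter_iota_lt (len p n) m); last exact: row_length_dual_le.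
    by apply: eq_in_filter => j; rewrite mem_iota => /andP[_ jm]; rewrite len_dual.
  - by move=> k kb; apply: row_length_mono; lia.
  - move=> k j kb kj.
    have kn : k < n by lia.
    have jm : j < m.
      case/andP: kj => _ /leq_trans; apply; exact: row_length_dual_le.
    rewrite (@levelE _ n k) //; first by move=> l ln; have /andP[] := holes_after_step ln jm.
    have := len_dual p k.+1 j kn jm; case/andP: kj => kj ->.
    move=> <-; last lia.
    (* For k = p the row is still empty and [row_length_dual] does not apply, but there are at most
       k zeros anyway. *)
    case: (ltngtP p k) kb => [pk _|//|-> _]; last by rewrite /holes_after leq_subr.
    by have := len_dual p k j (ltnW kn) jm pk; rewrite andbT; lia.
have -> : [seq flatten [seq nseq (row_length n m (mx_bit (transpose_complement A)) p k.+1 -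
     row_length n m (mx_bit (transpose_complement A)) p k) (n - k) | k <- iota p (n - p)]
     | p <- iota 0 n] =
   [seq [seq n - level (holes_after j) n p | j <- iota 0 m & p < holes_after j n] | p <- iota 0 n].
  by apply/eq_in_map => p; rewrite mem_iota => /andP[_ pn]; apply: rowE.
rewrite filter_map; congr map.
rewrite -(@filter_iota_lt (holes_after 0 n) n) ?leq_subr //.
apply: eq_filter => p /=; rewrite -size_eq0 size_map -lt0n size_filter -has_count.
apply/hasP/idP => [[j]|p0]; last by exists 0; rewrite // mem_iota.
by rewrite mem_iota => /andP[_ jm] /leq_trans; apply; apply: holes_after_anti.
Qed.

Lemma complement_recE : complement m n (rec A) =
  [seq [seq n - level (holes_after j) n p | j <- iota 0 m & p < holes_after j n]
     | p <- iota 0 (holes_after 0 n)].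
Proof.
rewrite /complement.
have -> : [seq [seq x <- rev (iota 1 n) | x \notin column (rec A) (m - q)] | q <- iota 1 m] =
  [seq [seq n - level (holes_after j) n p | p <- iota 0 (holes_after j n)] | j <- iota 0 m].
  have -> : iota 1 m = [seq 1 + j | j <- iota 0 m] by rewrite -iotaDl.
  rewrite -map_comp; apply/eq_in_map => j.
  by rewrite mem_iota => /andP[_ jm] /=; rewrite add1n complement_column.
set cols := map _ _; rewrite /tableau_of_columns.
have -> : \max_(c <- cols) size c = holes_after 0 n.
  rewrite big_map; apply/eqP; rewrite eqn_leq; apply/andP; split.
    apply/bigmax_leqP_seq => j; rewrite mem_iota => /andP[_ jm] _.
    by rewrite size_map size_iota holes_after_anti.
  have := @leq_bigmax_seq _ (iota 0 m) xpredT
    (fun j => size [seq n - level (holes_after j) n p | p <- iota 0 (holes_after j n)]) 0.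
  by rewrite mem_iota size_map size_iota; apply.
apply/eq_map => p; rewrite filter_map -map_comp.
have -> : [seq j <- iota 0 m |
    preim (fun j => [seq n - level (holes_after j) n p | p <- iota 0 (holes_after j n)])
      (fun c => p < size c) j] = [seq j <- iota 0 m | p < holes_after j n].
  by apply: eq_filter => j /=; rewrite size_map size_iota.
apply/eq_in_map => j; rewrite mem_filter => /andP[pj _] /=.
by rewrite (nth_map 0) ?size_iota // nth_iota.
Qed.

End Recording.

End SuperPipeDreams.

Theorem theorem1p2 (m n : nat) (m_gt0 : (0 < m)%N) (n_gt0 : (0 < n)%N)
    (A : 'M[bool]_(m, n)) :
  complement m n (rec A) = ins (transpose_complement A).
Proof. by rewrite complement_recE // insE_dual. Qed.
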